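(* Let $\mathcal{O}$ be a generalised octagon fully embedded in a metasymplectic space $\mathcal{M}$ such that the embedding is pseudo-isometric. Then the embedding of $\mathcal{O}$ in $\mathcal{M}$ is strongly polarised if, and only if, it is polarised.
   Context: Geometries. A geometry of rank $n$ is a tuple $(V_1,\dots,V_n,C)$ with $V_1,\dots,V_n$ disjoint non-empty sets and $C\subseteq V_1\times\dots\times V_n$ (chambers). Elements of distinct $V_i,V_j$ are incident if they lie in a common chamber. Elements of $V_1$ are points, elements of $V_2$ lines; two points are collinear if some line is incident with both. The geometry is connected if its incidence graph is connected. Its dual is $(V_n,\dots,V_1,C^D)$, chambers being read in reverse order. For $v\in V_i$, the $v$-shadow-geometry (resp. $v$-residue-geometry) consists of the elements of types $1,\dots,i-1$ (resp. $i+1,\dots,n$) incident with $v$, with chambers the corresponding truncations of the chambers containing $v$. Generalised octagon: a rank $2$ geometry of points and lines whose incidence graph has diameter $8$ and girth $16$, and such that for some cardinals $s,t\ge 2$ every point is incident with $t+1$ lines and every line with $s+1$ points. Polar space of rank $3$: a rank $3$ geometry of points, lines and planes (in the usual sense, the lines and planes being the singular subspaces of projective dimension $1$ and $2$, planes being the maximal singular subspaces) such that every line has at least $3$ points, no point is collinear with every other point, and for every point $x$ and line $L$ not incident with $x$, either exactly one or all points of $L$ are collinear to $x$. A dual polar space of rank $3$ is the dual of a polar space of rank $3$. Metasymplectic space: a connected rank $4$ geometry $\mathcal{M}$ of points, lines, planes and symplecta (symps), with at least two symps, such that (MS1) for each symp $\Sigma$ the $\Sigma$-shadow-geometry is a polar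 space of rank $3$; (MS2) for each point $x$ the $x$-residue-geometry is a dual polar space of rank $3$; (MS3) the intersection of two distinct symps is empty, a point, a line or a plane. Lines, planes and symps are identified with their sets of points. Two distinct points $x,y$ of $\mathcal{M}$ satisfy exactly one of: collinear; symplectic (not collinear, and there is a unique symp containing both); special (not collinear, and there is a unique point collinear to both); opposite (no point is collinear to both). Two distinct symps satisfy exactly one of: adjacent (they intersect in a plane); symplectic (they intersect in a unique point); special (there is a unique symp adjacent to both); opposite (no symp is adjacent to both). The words collinear, symplectic, special, opposite refer to $\mathcal{M}$. A generalised octagon $\mathcal{O}$ is fully embedded in $\mathcal{M}$ if its points and lines are points and lines of $\mathcal{M}$, incidence in $\mathcal{O}$ is that of $\mathcal{M}$, and for every line of $\mathcal{O}$ all points of $\mathcal{M}$ on it are points of $\mathcal{O}$. The distance of two points of $\mathcal{O}$ is their distance in the collinearity graph of $\mathcal{O}$. The (full) embedding is: - pseudo-isometric if two (distinct) points of $\mathcal{O}$ are at distance $1$, $2$, $3$, $4$ if, and only if, they are respectively collinear, symplectic, special, opposite; - polarised if through every point $x$ of $\mathcal{O}$ there exists a symp $x^\theta$ of $\mathcal{M}$ such that all points collinear to $x$ in $\mathcal{O}$ are contained in $x^\theta$; - strongly polarised if through every point $x$ of $\mathcal{O}$ there exists a unique symp $x^\theta$ of $\mathcal{M}$ such that all points collinear to $x$ in $\mathcal{O}$ are contained in $x^\theta$, and two points $x,y$ of $\mathcal{O}$ are collinear, symplectic, special or opposite, respectively, if, and only if, the symps $x^\theta$ and $y^\theta$ are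 adjacent, symplectic, special or opposite, respectively. *)

(* Defs.v *)
From mathcomp Require Import all_boot.
From mathcomp Require Import boolp classical_sets functions cardinality.

Set Implicit Arguments.
Unset Strict Implicit.
Unset Printing Implicit Defensive.

Local Open Scope classical_set_scope.
Local Open Scope card_scope.

Section Graphs.
Variables (T : Type) (A : set T) (e : T -> T -> Prop).

Fixpoint walk (n : nat) (x y : T) : Prop :=
  if n is m.+1 then exists z, e x z /\ walk m z y else x = y.

Definition distance (x y : T) (n : nat) : Prop :=
  walk n x y /\ forall m, (m < n)%N -> ~ walk m x y.

Definition connected_graph : Prop :=
  forall x y, A x -> A y -> exists n, walk n x y.

Definition diameter (d : nat) : Prop :=
  (forall x y, A x -> A y -> exists2 n, (n <= d)%N & distance x y n) /\
  (exists x y, [/\ A x, A y & distance x y d]).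

Definition has_cycle (n : nat) : Prop :=
  (2 < n)%N /\
  exists f : 'I_n -> T,
    [/\ forall i, A (f i), injective f & forall i, e (f i) (f (ordS i))].

Definition girth (g : nat) : Prop :=
  has_cycle g /\ forall n, has_cycle n -> (g <= n)%N.

End Graphs.

(** [elts G i] is the set V_(i+1) of the tuple (V_1, ..., V_n, C), where
    n = [rank G]; its values for [i >= rank G] are irrelevant.  A chamber
    (v_1, ..., v_n) is the sequence [:: v_1; ...; v_n]. *)
Record pregeometry (T : Type) := Pregeometry {
  rank : nat;
  elts : nat -> set T;
  chambers : set (seq T)
}.

Section Geometries.
Variables (T : Type) (G : pregeometry T).

Definition geometry : Prop :=
  [/\ forall i j, (i < rank G)%N -> (j < rank G)%N -> i <> j ->
        elts G i `&` elts G j = set0,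
      forall i, (i < rank G)%N -> elts G i !=set0 &
      forall c, chambers G c ->
        size c = rank G /\ forall i u, onth c i = Some u -> elts G i u].

Definition elements : set T := \bigcup_(i in `I_(rank G)) elts G i.

Definition incident (u v : T) : Prop :=
  exists c i j, [/\ chambers G c, i <> j, onth c i = Some u & onth c j = Some v].

Definition points := elts G 0.
Definition lines := elts G 1.
Definition planes := elts G 2.
Definition symps := elts G 3.

Definition pts (u : T) : set T := [set p | points p /\ incident p u].

(* With this definition a point lying on some line is collinear with itself. *)
Definition collinear (x y : T) : Prop :=
  exists2 L, lines L & pts L x /\ pts L y.

Definition connected_geometry : Prop := connected_graph elements incident.

Definition dual : pregeometry T :=
  Pregeometry (rank G) (fun i => elts G ((rank G).-1 - i)) (rev @` chambers G).

(* In the next two definitions, [v] is an element of [elts G i]. *)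
Definition shadow (i : nat) (v : T) : pregeometry T :=
  Pregeometry i (fun j => [set u | elts G j u /\ incident u v])
    (take i @` [set c | chambers G c /\ onth c i = Some v]).

Definition residue (i : nat) (v : T) : pregeometry T :=
  Pregeometry (rank G - i.+1)
    (fun j => [set u | elts G (i.+1 + j) u /\ incident v u])
    (drop i.+1 @` [set c | chambers G c /\ onth c i = Some v]).

Definition determined_by_points : Prop :=
  forall i u v, (0 < i < rank G)%N -> elts G i u -> elts G i v ->
    pts u = pts v -> u = v.

Definition singular_subspace (X : set T) : Prop :=
  [/\ X `<=` points,
      forall x y, X x -> X y -> x <> y -> collinear x y &
      forall L x y, lines L -> X x -> X y -> x <> y -> pts L x -> pts L y ->
        pts L `<=` X].

Definition maximal_singular (X : set T) : Prop :=
  singular_subspace X /\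
  forall Y, singular_subspace Y -> X `<=` Y -> Y = X.

(* [dim_ge k X]: some chain X_0 < X_1 < ... < X_k = X of nonempty singular
   subspaces exists. *)
Fixpoint dim_ge (k : nat) (X : set T) : Prop :=
  singular_subspace X /\
  if k is k'.+1 then exists2 Y, Y `<` X & dim_ge k' Y else X !=set0.

Definition proj_dim (X : set T) (k : nat) : Prop :=
  dim_ge k X /\ ~ dim_ge k.+1 X.

End Geometries.

Definition generalised_octagon T (O : pregeometry T) : Prop :=
  [/\ geometry O, rank O = 2,
      diameter (elements O) (incident O) 8,
      girth (elements O) (incident O) 16 &
      (* [option S] has cardinality s + 1 if [S] has cardinality s *)
      exists S S' : Type,
        [/\ `I_2 #<= [set: S], `I_2 #<= [set: S'],
            forall p, points O p ->
              [set L | lines O L /\ incident O p L] #= [set: option S'] &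
            forall L, lines O L -> pts O L #= [set: option S]]].

(** Lines and planes of a polar space, and lines, planes and symps of a
    metasymplectic space, are identified with their point sets: the point set
    determines the element, incidence is containment, and the chambers are the
    nested tuples. *)

Record polar_space3 T (G : pregeometry T) : Prop := PolarSpace3 {
  polar_geometry : geometry G;
  polar_rank : rank G = 3;
  polar_determined : determined_by_points G;
  polar_chambers : forall p L P, chambers G [:: p; L; P] <->
    [/\ lines G L, planes G P, pts G L p & pts G L `<=` pts G P];
  polar_lines : pts G @` lines G = [set X | proj_dim G X 1];
  polar_planes : pts G @` planes G = [set X | proj_dim G X 2];
  polar_maximal : pts G @` planes G = [set X | maximal_singular G X];
  polar_thick_lines : forall L, lines G L -> `I_3 #<= pts G L;
  polar_nondegenerate : forall x, points G x ->
    exists y, [/\ points G y, y <> x & ~ collinear G x y];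
  polar_one_or_all : forall x L, points G x -> lines G L -> ~ incident G x L ->
    (exists! y, pts G L y /\ collinear G x y) \/
    (forall y, pts G L y -> collinear G x y)
}.

Definition dual_polar_space3 T (G : pregeometry T) : Prop :=
  polar_space3 (dual G).

Record metasymplectic T (M : pregeometry T) : Prop := Metasymplectic {
  ms_geometry : geometry M;
  ms_rank : rank M = 4;
  ms_determined : determined_by_points M;
  ms_chambers : forall p L P S, chambers M [:: p; L; P; S] <->
    [/\ lines M L, planes M P & symps M S] /\
    [/\ pts M L p, pts M L `<=` pts M P & pts M P `<=` pts M S];
  ms_connected : connected_geometry M;
  ms_two_symps : `I_2 #<= symps M;
  MS1 : forall S, symps M S -> polar_space3 (shadow M 3 S);
  MS2 : forall x, points M x -> dual_polar_space3 (residue M 0 x);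
  MS3 : forall S1 S2, symps M S1 -> symps M S2 -> S1 <> S2 ->
    [\/ pts M S1 `&` pts M S2 = set0,
        exists2 p, points M p & pts M S1 `&` pts M S2 = [set p],
        exists2 L, lines M L & pts M S1 `&` pts M S2 = pts M L |
        exists2 P, planes M P & pts M S1 `&` pts M S2 = pts M P]
}.

Section Relations.
Variables (T : Type) (M : pregeometry T).

Definition symplectic (x y : T) : Prop :=
  [/\ x <> y, ~ collinear M x y &
      exists! S, symps M S /\ (pts M S x /\ pts M S y)].

Definition special (x y : T) : Prop :=
  [/\ x <> y, ~ collinear M x y &
      exists! z, collinear M x z /\ collinear M y z].

Definition opposite (x y : T) : Prop :=
  x <> y /\ ~ exists z, collinear M x z /\ collinear M y z.

Definition symp_adjacent (S1 S2 : T) : Prop :=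
  S1 <> S2 /\ exists2 P, planes M P & pts M S1 `&` pts M S2 = pts M P.

Definition symp_symplectic (S1 S2 : T) : Prop :=
  S1 <> S2 /\ exists2 p, points M p & pts M S1 `&` pts M S2 = [set p].

Definition symp_special (S1 S2 : T) : Prop :=
  S1 <> S2 /\
  exists! S, symps M S /\ (symp_adjacent S1 S /\ symp_adjacent S2 S).

Definition symp_opposite (S1 S2 : T) : Prop :=
  S1 <> S2 /\
  ~ exists S, symps M S /\ (symp_adjacent S1 S /\ symp_adjacent S2 S).

End Relations.

Section Embeddings.
Variables (T : Type) (O M : pregeometry T).

Definition fully_embedded : Prop :=
  [/\ points O `<=` points M, lines O `<=` lines M,
      forall p L, points O p -> lines O L -> (incident O p L <-> incident M p L) &
      forall L, lines O L -> pts M L `<=` points O].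

Definition octagon_distance : T -> T -> nat -> Prop :=
  distance (fun x y => x <> y /\ collinear O x y).

Definition pseudo_isometric : Prop :=
  forall x y, points O x -> points O y -> x <> y ->
    [/\ octagon_distance x y 1 <-> collinear M x y,
        octagon_distance x y 2 <-> symplectic M x y,
        octagon_distance x y 3 <-> special M x y &
        octagon_distance x y 4 <-> opposite M x y].

(* [S] is a candidate for the symp x^theta. *)
Definition polar_symp (x S : T) : Prop :=
  [/\ symps M S, pts M S x &
      forall y, points O y -> collinear O x y -> pts M S y].

Definition polarised : Prop :=
  forall x, points O x -> exists S, polar_symp x S.

Definition strongly_polarised : Prop :=
  (forall x, points O x -> exists! S, polar_symp x S) /\
  (forall x y Sx Sy, points O x -> points O y -> x <> y ->
    polar_symp x Sx -> polar_symp y Sy ->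
    [/\ collinear M x y <-> symp_adjacent M Sx Sy,
        symplectic M x y <-> symp_symplectic M Sx Sy,
        special M x y <-> symp_special M Sx Sy &
        opposite M x y <-> symp_opposite M Sx Sy]).

End Embeddings.

(* Main.v *)
From mathcomp Require Import all_boot zify.
From mathcomp Require Import boolp classical_sets functions cardinality.
Require Import Defs.

(** A strongly polarised embedding is polarised by definition.  For the
    converse, [x^theta] is unique because two points on different octagon lines
    through [x] are symplectic, hence lie in only one symp.  It then suffices to
    show that points of the octagon at distance 1, 2, 3, 4 have adjacent,
    symplectic, special, opposite symps respectively: any two points are at one
    of these distances, and the four relations between symps exclude each other
    (two symps with a common point have at least two common neighbours,
    [two_adjacent]).

    The geometric input is a small theory of metasymplectic spaces whose
    hypotheses ([metasymp]) are invariant under the duality that exchanges points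
    with symps and lines with planes: symps and, dually, residues of points are
    polar spaces, and two distinct points common to two distinct symps lie on a
    line contained in a plane of both symps.  The main consequences are:
    - three pairwise collinear points lie in a symp ([triangle]);
    - a point collinear to two noncollinear points of a symp lies in that symp
      ([symp_convex]);
    - two points with two common neighbours lie in a symp ([quadrangle]); dually,
      two symps with two common neighbours share a point.
    The first and the last rest on one construction ([fork]), which from
    collinear points of a symp, and neighbours of these off that symp, produces
    two symps meeting in a point that is not collinear to these neighbours.

    Write [Sx] for [x^theta].  At distance 1, [Sx] and [Sy] are distinct and share
    a line, hence a plane.  At distance 2 they share the midpoint, and a common plane would
    give a common neighbour of a point [u] next to [x] and a point [v] next to
    [y] that are opposite.  At distance 3, they are disjoint, since a common point
    would make two opposite points have a common neighbour; for the middle line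
    [K] of the path, the residues of its two points give a symp through [K]
    adjacent to both, and it is unique because two such symps would force [Sx]
    and [Sy] to meet.  At distance 4 they are again disjoint.  If a symp [S] were
    adjacent to both, take the three paths from [x] to [y] that leave [x] on three
    different lines, with second points [ai] and fourth points [ci].  By
    [no_bridge], [S] contains [ai] or [ci] for each path.  Two of the three choices
    are of the same kind, which puts, say, [ai] and [aj] in the plane common to
    [S] and [Sx], although they are not collinear. *)

Set Implicit Arguments.
Unset Strict Implicit.
Unset Printing Implicit Defensive.

(** * Polar spaces of rank 3, first-order *)

Definition relcomp {T} (R R' : T -> T -> Prop) (x z : T) : Prop :=
  exists2 y, R x y & R' y z.

Section PolarResidue.
Variables (T : Type) (Pt Ln Pl : T -> Prop) (J01 J12 : T -> T -> Prop).

(** A point is perpendicular to itself as soon as it lies on a line. *)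
Definition perp (p q : T) : Prop := exists L, [/\ Ln L, J01 p L & J01 q L].
Definition line_perp (p L : T) : Prop := forall q, J01 q L -> perp p q.

(** The properties of polar spaces of rank 3 used below.  Lines and planes are
    accessed through incidence relations that may be defined on a larger
    geometry, so the same relations serve all symps, and their converses all
    point residues, of a metasymplectic space. *)
Record polar : Prop := Polar {
  polar_line_plane : forall L P, Pl P -> J12 L P -> Ln L;
  polar_point_line : forall p L, Ln L -> J01 p L -> Pt p;
  polar_line_uniq : forall L L' p q, Ln L -> Ln L' -> p <> q ->
    J01 p L -> J01 q L -> J01 p L' -> J01 q L' -> L = L';
  polar_plane_line : forall P p q, Pl P -> p <> q ->
    relcomp J01 J12 p P -> relcomp J01 J12 q P ->
    exists L, [/\ J12 L P, J01 p L & J01 q L];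
  polar_proj : forall p L, Pt p -> Ln L -> exists2 q, J01 q L & perp p q;
  polar_all : forall p L q r, Pt p -> Ln L -> q <> r -> J01 q L -> J01 r L ->
    perp p q -> perp p r -> line_perp p L;
  polar_max : forall p P, Pt p -> Pl P ->
    (forall q, relcomp J01 J12 q P -> perp p q) -> relcomp J01 J12 p P;
  polar_hyp : forall p P L f, Pt p -> Pl P -> J12 L P -> line_perp p L ->
    relcomp J01 J12 f P -> ~ J01 f L -> perp p f ->
    forall q, relcomp J01 J12 q P -> perp p q;
  polar_tri : forall a b c, Pt a -> Pt b -> Pt c ->
    perp a b -> perp a c -> perp b c ->
    exists P, [/\ Pl P, relcomp J01 J12 a P, relcomp J01 J12 b P & relcomp J01 J12 c P];
  polar_off : forall P a, Pl P -> exists2 L, J12 L P & ~ J01 a L;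
  polar_thick : forall L, Ln L -> exists a b c,
    [/\ a <> b, a <> c & b <> c] /\ [/\ J01 a L, J01 b L & J01 c L];
  polar_plane_ext : forall P P', Pl P -> Pl P' ->
    (forall q, relcomp J01 J12 q P -> relcomp J01 J12 q P') -> P = P'
}.

Hypothesis HP : polar.

Local Notation on_plane := (relcomp J01 J12).

Lemma line_on_plane L P p : J01 p L -> J12 L P -> on_plane p P.
Proof. by move=> ? ?; exists L. Qed.

Lemma other_point L a : Ln L -> exists2 b, b <> a & J01 b L.
Proof.
move=> /(polar_thick HP) [p [q [_ [[pq _ _] [Hp Hq _]]]]].
have [pa|pa] := EM (p = a); last by exists p.
by exists q => // qa; apply: pq; rewrite pa qa.
Qed.

Lemma line_in_plane L P p q : Pl P -> Ln L -> p <> q -> J01 p L -> J01 q L ->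
  on_plane p P -> on_plane q P -> J12 L P.
Proof.
move=> HPl HL pq pL qL pP qP.
have [N [NP pN qN]] := polar_plane_line HP HPl pq pP qP.
by rewrite (polar_line_uniq HP HL (polar_line_plane HP HPl NP) pq pL qL pN qN).
Qed.

Lemma plane_perp P p q : Pl P -> on_plane p P -> on_plane q P -> perp p q.
Proof.
move=> HPl pP qP; have [->|pq] := EM (p = q).
  by case: qP => L qL LP; exists L; split => //; apply: polar_line_plane LP.
have [N [NP pN qN]] := polar_plane_line HP HPl pq pP qP.
by exists N; split => //; apply: polar_line_plane NP.
Qed.

(** A hyperplane argument: inside a plane, the points collinear to a given one
    form a singular subspace, so they cannot contain a line properly without
    being the whole plane, and then maximality of planes applies. *)
Lemma on_plane_hyp p P L f : Pt p -> Pl P -> J12 L P -> line_perp p L ->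
  on_plane f P -> ~ J01 f L -> perp p f -> on_plane p P.
Proof.
move=> pt HPl LP pL fP fL pf; apply: (polar_max HP) => // q qP.
exact: (polar_hyp HP pt HPl LP pL fP fL pf).
Qed.

Lemma point_off_line P L : Pl P -> Ln L -> exists2 p, on_plane p P & ~ J01 p L.
Proof.
move=> HPl HL; have [a [_ [_ [_ [aL _ _]]]]] := polar_thick HP HL.
have [M MP aM] := polar_off HP a HPl.
have HN := polar_line_plane HP HPl MP.
have [p [q [_ [[pq _ _] [pM qM _]]]]] := polar_thick HP HN.
have [pL|pL] := EM (J01 p L); last by exists p => //; apply: line_on_plane MP.
exists q; first exact: line_on_plane MP.
by move=> qL; apply: aM; rewrite (polar_line_uniq HP HN HL pq pM qM pL qL).
Qed.

Lemma perp_line_through p P a : Pt p -> Pl P -> on_plane a P -> perp p a ->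
  exists k, [/\ J12 k P, J01 a k & line_perp p k].
Proof.
move=> pt HPl aP pa; have [M MP aM] := polar_off HP a HPl.
have HM := polar_line_plane HP HPl MP.
have [w wM pw] := polar_proj HP pt HM.
have aw : a <> w by move=> E; apply: aM; rewrite E.
have [k [kP ak wk]] := polar_plane_line HP HPl aw aP (line_on_plane wM MP).
exists k; split => //.
exact: (polar_all HP pt (polar_line_plane HP HPl kP) aw).
Qed.

Lemma perp_line p P : Pt p -> Pl P -> exists2 k, J12 k P & line_perp p k.
Proof.
move=> pt HPl; have [M MP _] := polar_off HP p HPl.
have [w wM pw] := polar_proj HP pt (polar_line_plane HP HPl MP).
by have [k [? _ ?]] := perp_line_through pt HPl (line_on_plane wM MP) pw; exists k.
Qed.

Lemma span_plane p k : Pt p -> Ln k -> line_perp p k ->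
  exists P, [/\ Pl P, J12 k P & on_plane p P].
Proof.
move=> pt Hk pk; have [a [b [_ [[ab _ _] [ak bk _]]]]] := polar_thick HP Hk.
have [|P [HPl pP aP bP]] := polar_tri HP pt (polar_point_line HP Hk ak)
    (polar_point_line HP Hk bk) (pk _ ak) (pk _ bk); first by exists k.
by exists P; split => //; apply: line_in_plane ab ak bk aP bP.
Qed.

End PolarResidue.

(** * Metasymplectic spaces as self-dual flag geometries *)

Definition point_symp {T} (I01 I12 I23 : T -> T -> Prop) : T -> T -> Prop :=
  relcomp I01 (relcomp I12 I23).

(** [I01], [I12], [I23] relate points to lines, lines to planes, planes to symps.
    In the residue of a point, symps play the role of points, planes that of
    lines, and lines that of planes.  The last field is the self-dual form of
    the axiom on intersections of symps. *)
Record metasymp T (I01 I12 I23 : T -> T -> Prop) : Prop := Metasymp {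
  symp_polar : forall P0 S, I23 P0 S ->
    polar (fun p => point_symp I01 I12 I23 p S) (fun L => relcomp I12 I23 L S)
      (fun P => I23 P S) I01 I12;
  point_polar : forall x L0, I01 x L0 ->
    polar (fun S => point_symp I01 I12 I23 x S) (fun P => relcomp I01 I12 x P)
      (fun L => I01 x L) (fun S P => I23 P S) (fun P L => I12 L P);
  flag_extend : forall L P, I12 L P ->
    (exists x, I01 x L) /\ (exists S, I23 P S);
  two_points_two_symps : forall x y S S', x <> y -> S <> S' ->
    point_symp I01 I12 I23 x S -> point_symp I01 I12 I23 y S ->
    point_symp I01 I12 I23 x S' -> point_symp I01 I12 I23 y S' ->
    exists L P, [/\ I01 x L, I01 y L, I12 L P, I23 P S & I23 P S']
}.

Lemma point_symp_dual T (I01 I12 I23 : T -> T -> Prop) x S :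
  point_symp (fun S P => I23 P S) (fun P L => I12 L P) (fun L x => I01 x L) S x
  = point_symp I01 I12 I23 x S.
Proof.
apply: propext; split.
  by case=> P PS [L LP xL]; exists L => //; exists P.
by case=> L xL [P LP PS]; exists P => //; exists L.
Qed.

Lemma relcomp_dual T (R R' : T -> T -> Prop) x z :
  relcomp (fun z y => R' y z) (fun y x => R x y) z x = relcomp R R' x z.
Proof. by apply: propext; split; case=> y ? ?; exists y. Qed.

Lemma metasymp_dual T (I01 I12 I23 : T -> T -> Prop) :
  metasymp I01 I12 I23 ->
  metasymp (fun S P => I23 P S) (fun P L => I12 L P) (fun L x => I01 x L).
Proof.
move=> HM; split.
- move=> L0 x xL.
  have -> : (fun p => point_symp (fun S P => I23 P S) (fun P L => I12 L P)
      (fun L x => I01 x L) p x) = (fun S => point_symp I01 I12 I23 x S).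
    by apply: funext => S; apply: point_symp_dual.
  have -> : (fun P => relcomp (fun P L => I12 L P) (fun L x => I01 x L) P x)
      = relcomp I01 I12 x.
    by apply: funext => P; apply: relcomp_dual.
  exact: point_polar xL.
- move=> S P0 PS.
  have -> : (fun p => point_symp (fun S P => I23 P S) (fun P L => I12 L P)
      (fun L x => I01 x L) S p) = (fun x => point_symp I01 I12 I23 x S).
    by apply: funext => x; apply: point_symp_dual.
  have -> : (fun L => relcomp (fun S P => I23 P S) (fun P L => I12 L P) S L)
      = (fun L => relcomp I12 I23 L S).
    by apply: funext => L; apply: relcomp_dual.
  exact: symp_polar PS.
- by move=> P L LP; have [? ?] := flag_extend HM LP.
- move=> S S' x y SS xy; rewrite !(point_symp_dual I01 I12 I23) => xS xS' yS yS'.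
  have [L [P [? ? ? ? ?]]] := two_points_two_symps HM xy SS xS yS xS' yS'.
  by exists P, L.
Qed.

Section Metasymp.
Variables (T : Type) (I01 I12 I23 : T -> T -> Prop).
Hypothesis HM : metasymp I01 I12 I23.

Local Notation I02 := (relcomp I01 I12).
Local Notation I13 := (relcomp I12 I23).
Local Notation I03 := (point_symp I01 I12 I23).

Definition col (x y : T) : Prop := exists2 L, I01 x L & I01 y L.
Definition cosymp (x y : T) : Prop := exists2 S, I03 x S & I03 y S.
(** Like [col] on points, this relation is reflexive on symps. *)
Definition adjacent (S S' : T) : Prop := exists2 P, I23 P S & I23 P S'.

Lemma colC x y : col x y -> col y x.
Proof. by case=> L ? ?; exists L. Qed.

Lemma polar_at_symp x S : I03 x S ->
  polar (fun p => I03 p S) (fun L => I13 L S) (fun P => I23 P S) I01 I12.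
Proof. by case=> L _ [P _ PS]; exact: (symp_polar HM PS). Qed.

Lemma polar_at_point x S : I03 x S ->
  polar (fun S => I03 x S) (fun P => I02 x P) (fun L => I01 x L)
    (fun S P => I23 P S) (fun P L => I12 L P).
Proof. by case=> L xL _; exact: (point_polar HM xL). Qed.

Lemma point_plane_symp x P S : I02 x P -> I23 P S -> I03 x S.
Proof. by case=> L xL LP PS; exists L => //; exists P. Qed.

Lemma line_symp_exists x L : I01 x L -> exists S, I13 L S.
Proof.
move=> xL; have [P LP _] := polar_off (point_polar HM xL) x xL.
by have [_ [S PS]] := flag_extend HM LP; exists S, P.
Qed.

(** Collinearity in a symp and in the whole space agree. *)
Lemma line_in_symp x y L S : x <> y -> I01 x L -> I01 y L ->
  I03 x S -> I03 y S -> I13 L S.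
Proof.
move=> xy xL yL xS yS; have [S' LS'] := line_symp_exists xL.
have [<-//|SS] := EM (S' = S).
have xS' : I03 x S' by exists L.
have yS' : I03 y S' by exists L.
have [N [P [xN yN NP PS' PS]]] := two_points_two_symps HM xy SS xS' yS' xS yS.
suff -> : L = N by exists P.
apply: (polar_line_uniq (polar_at_symp xS') LS' _ xy) => //.
by exists P.
Qed.

Lemma line_uniq x y L L' : x <> y -> I01 x L -> I01 y L ->
  I01 x L' -> I01 y L' -> L = L'.
Proof.
move=> xy xL yL xL' yL'; have [S LS] := line_symp_exists xL.
have xS : I03 x S by exists L.
have yS : I03 y S by exists L.
apply: (polar_line_uniq (polar_at_symp xS) LS _ xy) => //.
exact: line_in_symp xy xL' yL' xS yS.
Qed.

Lemma perp_col S x y : perp (fun L => I13 L S) I01 x y -> col x y.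
Proof. by case=> L [_ xL yL]; exists L. Qed.

Lemma col_perp S x y : col x y -> I03 x S -> I03 y S ->
  perp (fun L => I13 L S) I01 x y.
Proof.
case=> L xL yL xS yS; have [<-|xy] := EM (x = y).
  by case: xS => N xN NS; exists N.
by exists L; split => //; apply: line_in_symp xy xL yL xS yS.
Qed.

Lemma symp_refl x S : I03 x S -> col x x.
Proof. by case=> L xL _; exists L. Qed.

Lemma col_two_symps x y S S' : S <> S' -> I03 x S -> I03 y S ->
  I03 x S' -> I03 y S' -> col x y.
Proof.
move=> SS xS yS xS' yS'; have [<-|xy] := EM (x = y); first exact: symp_refl xS.
by have [L [P [xL yL _ _ _]]] := two_points_two_symps HM xy SS xS yS xS' yS'; exists L.
Qed.

(** Each point common to both symps is collinear to all points of [P], and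
    planes are maximal singular subspaces. *)
Lemma adjacent_inter P S S' x : S <> S' -> I23 P S -> I23 P S' ->
  I03 x S -> I03 x S' -> I02 x P.
Proof.
move=> SS PS PS' xS xS'; apply: (polar_max (polar_at_symp xS)) => // q qP.
have qS := point_plane_symp qP PS.
by apply: col_perp => //; apply: col_two_symps SS _ _ _ _ => //;
  apply: point_plane_symp qP _.
Qed.

Lemma plane_col x y P : I02 x P -> I02 y P -> col x y.
Proof.
move=> xP yP; case: (xP) => L _ LP; have [_ [S PS]] := flag_extend HM LP.
exact: (perp_col (plane_perp (polar_at_symp (point_plane_symp xP PS)) PS xP yP)).
Qed.

Lemma line_other x L : I01 x L -> exists2 y, y <> x & I01 y L.
Proof.
move=> xL; have [S LS] := line_symp_exists xL.
have xS : I03 x S by exists L.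
exact: (other_point (polar_at_symp xS) x LS).
Qed.

Lemma col_plane_line x y P : x <> y -> I02 x P -> I02 y P ->
  exists L, [/\ I12 L P, I01 x L & I01 y L].
Proof.
move=> xy xP yP; case: (xP) => L _ LP; have [_ [S PS]] := flag_extend HM LP.
exact: (polar_plane_line (polar_at_symp (point_plane_symp xP PS)) PS xy xP yP).
Qed.

Lemma line_plane x y L P : x <> y -> I01 x L -> I01 y L -> I02 x P -> I02 y P ->
  I12 L P.
Proof.
move=> xy xL yL xP yP; have [N [NP xN yN]] := col_plane_line xy xP yP.
by rewrite (line_uniq xy xL yL xN yN).
Qed.

Definition col_line (x L : T) : Prop := forall y, I01 y L -> col x y.

Lemma col_line_perp S x L : col_line x L -> I03 x S -> I13 L S ->
  line_perp (fun L => I13 L S) I01 x L.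
Proof. by move=> xL xS LS q qL; apply: col_perp => //; [exact: xL|exists L]. Qed.

Lemma col_all x L q r : q <> r -> I01 q L -> I01 r L -> forall S, I03 x S ->
  I13 L S -> col x q -> col x r -> col_line x L.
Proof.
move=> qr qL rL S xS LS xq xr y yL.
have inS z : I01 z L -> I03 z S by exists L.
apply: perp_col; apply: (polar_all (polar_at_symp xS) xS LS qr qL rL _ _ yL);
  by apply: col_perp => //; apply: inS.
Qed.

Lemma col_proj x L S : I03 x S -> I13 L S -> exists2 q, I01 q L & col x q.
Proof.
move=> xS LS; have [q qL pq] := polar_proj (polar_at_symp xS) xS LS.
by exists q => //; apply: perp_col pq.
Qed.

Lemma col_plane S x P L f : I03 x S -> I23 P S -> I12 L P -> col_line x L ->
  I02 f P -> ~ I01 f L -> col x f -> I02 x P.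
Proof.
move=> xS PS LP xL fP fL xf; have HS := polar_at_symp xS.
apply: (on_plane_hyp HS xS PS LP _ fP fL).
  by apply: col_line_perp => //; exists P.
by apply: col_perp => //; apply: point_plane_symp fP PS.
Qed.

Lemma col_span S x L : I03 x S -> I13 L S -> col_line x L ->
  exists P, [/\ I23 P S, I12 L P & I02 x P].
Proof.
by move=> xS LS xL; apply: (span_plane (polar_at_symp xS)) => //; apply: col_line_perp.
Qed.

Lemma col_line_in_plane S x P : I03 x S -> I23 P S ->
  exists2 k, I12 k P & col_line x k.
Proof.
move=> xS PS; have [k kP xk] := perp_line (polar_at_symp xS) xS PS.
by exists k => // y yk; apply: perp_col (xk y yk).
Qed.

Lemma plane_symp_exists x P : I02 x P -> exists S, I23 P S.
Proof. by case=> L _ LP; have [_] := flag_extend HM LP. Qed.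

Lemma col_line_through S x a P : I03 x S -> I23 P S -> I02 a P -> col x a ->
  exists k, [/\ I12 k P, I01 a k & col_line x k].
Proof.
move=> xS PS aP xa; have aS := point_plane_symp aP PS.
have [k [kP ak xk]] :=
  perp_line_through (polar_at_symp xS) xS PS aP (col_perp xa xS aS).
by exists k; split => // y yk; apply: perp_col (xk y yk).
Qed.

(** In the residue at [x], the line [zx] is a plane and [S] a point, so some
    symp through [zx] is adjacent to [S]. *)
Lemma project_point S x z : I03 x S -> ~ I03 z S -> col z x ->
  exists S' P k, [/\ I03 z S', I23 P S' & I23 P S] /\
                 [/\ I12 k P, I01 x k & col_line z k].
Proof.
move=> xS zS [L zL xL].
have HX := polar_at_point xS.
have [R LR SR] := perp_line HX xS xL.
have [S' RS'] := plane_symp_exists (line_on_plane xL LR).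
have [P [xP PS PS']] := SR S' RS'.
have LS' : I13 L S' by exists R.
have zS' : I03 z S' by exists L.
have [k [kP xk zk]] := col_line_through zS' PS' xP (ex_intro2 _ _ L zL xL).
by exists S', P, k.
Qed.

(** Two lines [l], [m] of a plane [P] meet: a point off [P], in another plane
    on [l] of the same symp, is collinear to [l] and to a point of [m], so it
    would be collinear to all of [P] if that point were off [l]. *)
Lemma lines_meet l m P : I12 l P -> I12 m P -> exists2 p, I01 p l & I01 p m.
Proof.
move=> lP mP; have [[x xl] [S PS]] := flag_extend HM lP.
have xP : I02 x P by exists l.
have xS := point_plane_symp xP PS.
have HX := polar_at_point xS; have HS := polar_at_symp xS.
have lS : I13 l S by exists P.
have mS : I13 m S by exists P.
(* In the residue at x, the plane l has a point S' off the line P; the line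
   joining S to S' is another plane of S through l. *)
have [S' lS' PS'] := point_off_line HX xl xP.
have SS : S <> S' by move=> E; apply: PS'; rewrite -E.
have [P' [lP' P'S P'S']] := polar_plane_line HX xl SS (line_on_plane PS lP) lS'.
have [q [qP' qP]] : exists q, I02 q P' /\ ~ I02 q P.
  apply: contrapT => H; apply: PS'; rewrite -(polar_plane_ext HS P'S PS) //.
  by move=> q qP'; apply: contrapT => qP; apply: H; exists q.
have qS := point_plane_symp qP' P'S.
have ql : col_line q l by move=> y yl; apply: plane_col qP' (line_on_plane yl lP').
have [f fm qf] := col_proj qS mS.
have [fl|fl] := EM (I01 f l); first by exists f.
by case: qP; apply: (col_plane qS PS lP ql _ fl qf); exists m.
Qed.

(** In the residue at [x], three pairwise collinear points lie in a plane. *)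
Lemma three_adjacent x S1 S2 S3 P12 P13 P23 : I02 x P12 -> I02 x P13 ->
  I02 x P23 -> I23 P12 S1 -> I23 P12 S2 -> I23 P13 S1 -> I23 P13 S3 ->
  I23 P23 S2 -> I23 P23 S3 ->
  exists m, [/\ I01 x m, I13 m S1, I13 m S2 & I13 m S3].
Proof.
move=> x12 x13 x23 h1 h2 h3 h4 h5 h6.
have xS1 := point_plane_symp x12 h1; have HX := polar_at_point xS1.
have [|||m [xm [A ? ?] [B ? ?] [C ? ?]]] := polar_tri HX xS1
    (point_plane_symp x12 h2) (point_plane_symp x13 h4).
- by exists P12.
- by exists P13.
- by exists P23.
by exists m; split => //; [exists A|exists B|exists C].
Qed.

End Metasymp.

(** * Convexity of symps and common neighbours *)

Lemma planes_cosymp T (I01 I12 I23 : T -> T -> Prop)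
    (HM : metasymp I01 I12 I23) l P P' :
  I12 l P -> I12 l P' -> exists2 S, I23 P S & I23 P' S.
Proof. exact: (lines_meet (metasymp_dual HM)). Qed.

Section Convexity.
Variables (T : Type) (I01 I12 I23 : T -> T -> Prop).
Hypothesis HM : metasymp I01 I12 I23.

Local Notation I02 := (relcomp I01 I12).
Local Notation I13 := (relcomp I12 I23).
Local Notation I03 := (point_symp I01 I12 I23).
Local Notation col := (col I01).
Local Notation cosymp := (cosymp I01 I12 I23).
Local Notation adjacent := (adjacent I23).

(** The symp [S1] contains [s] and a line [k] of [S0] through [a] with [s] collinear
    to all of it; similarly [t] is collinear to all of a line [k'] of [S0] through
    [b].  The
    hypotheses on [s] and [t] put [k] and [k'] in general position in [S0].  The
    point [p] is chosen in the plane common to [S0] and [S1] so as to be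
    collinear to all of [k'], and [S2] contains the planes spanned by [k'] with
    [t] and with [p]. *)
Lemma fork S0 a b s t : I03 a S0 -> I03 b S0 -> col a b -> col s a -> col t b ->
  (forall S, I03 s S -> I03 a S -> I03 b S -> False) ->
  (forall S, I03 t S -> I03 a S -> I03 b S -> False) ->
  exists S1 S2 p P1 P2, [/\ I03 s S1, I03 a S1, I03 t S2 & I03 b S2] /\
    [/\ I02 p P1, I23 P1 S0, I23 P1 S1 & [/\ I02 p P2, I23 P2 S0 & I23 P2 S2]] /\
    [/\ ~ col s p, ~ col t p & forall m, I13 m S0 -> I13 m S1 -> I13 m S2 -> False].
Proof.
move=> aS0 bS0 ab sa tb Hs Ht.
have sS0 : ~ I03 s S0 by move=> h; apply: (Hs S0).
have tS0 : ~ I03 t S0 by move=> h; apply: (Ht S0).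
have [S1 [P1 [k [[sS1 P1S1 P1S0] [kP1 ak sk]]]]] := project_point HM aS0 sS0 sa.
have [S' [P' [k' [[tS' P'S' P'S0] [kP' bk' tk']]]]] := project_point HM bS0 tS0 tb.
have aS1 : I03 a S1 by exists k => //; exists P1.
have bS' : I03 b S' by exists k' => //; exists P'.
have kS0 : I13 k S0 by exists P1.
have kS1 : I13 k S1 by exists P1.
have k'S0 : I13 k' S0 by exists P'.
have k'S' : I13 k' S' by exists P'.
have bS1 : ~ I03 b S1 by move=> h; apply: (Hs S1).
(* No point of k other than a is collinear to b: otherwise the planes spanned
   by k and s, and by k and b, would lie in a common symp. *)
have kb w : I01 w k -> w <> a -> ~ col b w.
  move=> wk wa bw.
  have bk : col_line I01 b k.
    by apply: (col_all HM wa wk ak bS0 kS0 bw); apply: colC.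
  have [Q [QS0 kQ bQ]] := col_span HM bS0 kS0 bk.
  have [R [RS1 kR sR]] := col_span HM sS1 kS1 sk.
  have [S QS RS] := planes_cosymp HM kQ kR.
  apply: (Hs S); [exact: point_plane_symp RS|exact: point_plane_symp (line_on_plane ak kQ) QS|].
  exact: point_plane_symp bQ QS.
have ka w : I01 w k' -> w <> b -> ~ col a w.
  move=> wk wb aw.
  have ak' : col_line I01 a k' by apply: (col_all HM wb wk bk' aS0 k'S0 aw ab).
  have [Q [QS0 kQ aQ]] := col_span HM aS0 k'S0 ak'.
  have [R [RS1 kR tR]] := col_span HM tS' k'S' tk'.
  have [S QS RS] := planes_cosymp HM kQ kR.
  apply: (Ht S); [exact: point_plane_symp RS|exact: point_plane_symp aQ QS|].
  exact: point_plane_symp (line_on_plane bk' kQ) QS.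
have [e eb ek'] := line_other HM bk'.
have eS0 : I03 e S0 by exists k'.
(* The point p of P1 is collinear to b and to e, hence to all of k'. *)
have [h hP1 bh] := col_line_in_plane HM bS0 P1S0.
have hS0 : I13 h S0 by exists P1.
have [p ph ep] := col_proj HM eS0 hS0.
have pP1 : I02 p P1 by exists h.
have pS0 := point_plane_symp pP1 P1S0.
have pS1 := point_plane_symp pP1 P1S1.
have pk' : col_line I01 p k'.
  by apply: (col_all HM eb ek' bk' pS0 k'S0); apply: colC => //; apply: bh.
have ap : col a p by apply: (plane_col HM _ pP1); exists k.
have npk : ~ I01 p k.
  move=> pk; have [E|pa] := EM (p = a); last by apply: (kb p pk pa); apply: bh.
  by apply: (ka e ek' eb); rewrite -E; apply: pk'.
have npk' : ~ I01 p k'.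
  by move=> h'; have [E|pb] := EM (p = b); [apply: bS1; rewrite -E|apply: (ka p)].
have sp : ~ col s p.
  move=> sp; apply: sS0; apply: point_plane_symp P1S0.
  exact: (col_plane HM sS1 P1S1 kP1 sk pP1 npk sp).
have [Q [QS0 kQ pQ]] := col_span HM pS0 k'S0 pk'.
have [R [RS' kR tR]] := col_span HM tS' k'S' tk'.
have [S2 QS2 RS2] := planes_cosymp HM kQ kR.
have tS2 := point_plane_symp tR RS2.
have S20 : S2 <> S0 by move=> E; apply: tS0; rewrite -E.
have S10 : S1 <> S0 by move=> E; apply: sS0; rewrite -E.
exists S1, S2, p, P1, Q; split; first split => //.
  exact: point_plane_symp (line_on_plane bk' kQ) QS2.
split; first by split.
split => // [tp|m mS0 mS1 mS2].
  apply: tS0; apply: point_plane_symp QS0.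
  exact: (col_plane HM tS2 QS2 kQ tk' pQ npk' tp).
(* A common line m would meet k in a point of the plane Q, which is collinear
   to all of k'. *)
have mQ w : I01 w m -> I02 w Q.
  by move=> wm; apply: (adjacent_inter HM S20 QS2 QS0); exists m.
have mP1 w : I01 w m -> I02 w P1.
  by move=> wm; apply: (adjacent_inter HM S10 P1S1 P1S0); exists m.
case: (mS0) => M mM _; have [[c cm] _] := flag_extend HM mM.
have [d dc dm] := line_other HM cm.
have [w wm wk] := lines_meet HM (line_plane HM dc dm cm (mP1 _ dm) (mP1 _ cm)) kP1.
have wk' y : I01 y k' -> col w y.
  by move=> yk'; apply: (plane_col HM (mQ _ wm) (line_on_plane yk' kQ)).
have [E|wa] := EM (w = a); first by apply: (ka e ek' eb); rewrite -E; apply: wk'.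
by apply: (kb w wk wa); apply: colC; apply: wk'.
Qed.

(** In the absence of such a symp, [fork], with both outer points equal to [z],
    yields two symps that share the noncollinear points [z] and [p]. *)
Lemma triangle x y z : col x y -> col x z -> col y z ->
  exists S, [/\ I03 x S, I03 y S & I03 z S].
Proof.
move=> xy xz yz; apply: contrapT => H.
have HN S : I03 z S -> I03 x S -> I03 y S -> False.
  by move=> ? ? ?; apply: H; exists S.
case: (xy) => L xL yL; have [S0 LS0] := line_symp_exists HM xL.
have xS0 : I03 x S0 by exists L.
have yS0 : I03 y S0 by exists L.
have [S1 [S2 [p [P1 [P2 [[zS1 xS1 zS2 yS2] [[pP1 _ P1S1 [pP2 _ P2S2]] [zp _ _]]]]]]]] :=
  fork xS0 yS0 xy (colC xz) (colC yz) HN HN.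
have S12 : S1 <> S2 by move=> E; apply: (HN S1) => //; rewrite E.
apply: zp; apply: (col_two_symps HM S12 zS1 _ zS2).
  exact: point_plane_symp pP1 P1S1.
exact: point_plane_symp pP2 P2S2.
Qed.

(** If [z] is off [S], it lies in a symp [S1] adjacent to [S] through [x], and with
    [y] and a common neighbour [e] of [x] and [y] in a symp [S2].  The three symps
    share a line on [e], which together with [z] spans the plane common to [S1]
    and [S2]; this plane contains [y] by maximality, and so [y] is in [S1],
    whose intersection with [S] is a plane containing [x]. *)
Lemma symp_convex S x y z : I03 x S -> I03 y S -> ~ col x y ->
  col z x -> col z y -> I03 z S.
Proof.
move=> xS yS xy zx zy; apply: contrapT => zS.
have [S1 [P [k [[zS1 PS1 PS] [kP xk zk]]]]] := project_point HM xS zS zx.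
have [e ek ye] := col_proj HM yS (ex_intro2 _ _ P kP PS : I13 k S).
have eP : I02 e P by exists k.
have eS := point_plane_symp eP PS; have eS1 := point_plane_symp eP PS1.
have [S2 [zS2 eS2 yS2]] := triangle (zk _ ek) zy (colC ye).
have S1S : S1 <> S by move=> E; apply: zS; rewrite -E.
have S2S : S2 <> S by move=> E; apply: zS; rewrite -E.
have yS1 : ~ I03 y S1.
  move=> yS1; apply: xy; apply: (plane_col HM (line_on_plane xk kP)).
  exact: (adjacent_inter HM S1S PS1 PS).
have S12 : S1 <> S2 by move=> E; apply: yS1; rewrite E.
have ze : z <> e by move=> E; apply: zS; rewrite E.
have ye' : y <> e by move=> E; apply: yS1; rewrite E.
have [N [P2 [yN eN NP2 P2S2 P2S]]] := two_points_two_symps HM ye' S2S yS2 eS2 yS eS.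
have [N' [Q [zN' eN' NQ QS1 QS2]]] := two_points_two_symps HM ze S12 zS1 eS1 zS2 eS2.
have eQ : I02 e Q by exists N'.
have eP2 : I02 e P2 by exists N.
have [m [em mS mS1 mS2]] := three_adjacent HM eP eP2 eQ PS PS1 P2S P2S2 QS1 QS2.
have mQ w : I01 w m -> I02 w Q.
  by move=> wm; apply: (adjacent_inter HM S12 QS1 QS2); exists m.
have ym : col_line I01 y m.
  by move=> w wm; apply: (col_two_symps HM S2S yS2 _ yS); exists m.
have [f fe fm] := line_other HM em.
apply: yS1; apply: point_plane_symp QS1.
apply: (col_plane HM yS2 QS2 (line_plane HM fe fm em (mQ _ fm) (mQ _ em)) ym
          (line_on_plane zN' NQ) _ (colC zy)).
by move=> zm; apply: zS; exists m.
Qed.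

(** If [s] and [s'] are collinear, two triangles give planes on the line [ss'],
    and planes on a line lie in a symp.  If they are noncollinear points
    of a symp, convexity applies.  Otherwise [fork] applies along the path [s], [t1], [s'], [t2]; as
    [s] and [t2] are collinear too, the symps [S1], [S2] it provides share not only [p]
    but, by convexity, also a neighbour [j] of [p], hence a plane.  So these two
    and [S0] are pairwise adjacent and would share a line. *)
Lemma quadrangle s s' t1 t2 : s <> s' -> col s t1 -> col s t2 ->
  col s' t1 -> col s' t2 -> t1 <> t2 -> cosymp t1 t2.
Proof.
move=> ss st1 st2 st1' st2' tt; apply: contrapT => nt.
have [ss'|nss'] := EM (col s s').
  have [S1 [sS1 sS1' tS1]] := triangle ss' st1 st1'.
  have [S2 [sS2 sS2' tS2]] := triangle ss' st2 st2'.
  case: (ss') => N sN sN'.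
  have NS1 := line_in_symp HM ss sN sN' sS1 sS1'.
  have NS2 := line_in_symp HM ss sN sN' sS2 sS2'.
  have [Q1 [_ NQ1 tQ1]] := col_span HM tS1 NS1
    (col_all HM ss sN sN' tS1 NS1 (colC st1) (colC st1')).
  have [Q2 [_ NQ2 tQ2]] := col_span HM tS2 NS2
    (col_all HM ss sN sN' tS2 NS2 (colC st2) (colC st2')).
  have [S Q1S Q2S] := planes_cosymp HM NQ1 NQ2.
  by apply: nt; exists S; [apply: point_plane_symp Q1S|apply: point_plane_symp Q2S].
have [[S sS sS']|nS] := EM (cosymp s s').
  by apply: nt; exists S; [apply: symp_convex sS sS' nss' (colC _) (colC _)
                          |apply: symp_convex sS sS' nss' (colC _) (colC _)].
have [L t1L sL] := st1'; have [S0 LS0] := line_symp_exists HM t1L.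
have t1S0 : I03 t1 S0 by exists L.
have sS0' : I03 s' S0 by exists L.
have H1 S : I03 s S -> I03 t1 S -> I03 s' S -> False.
  by move=> ? _ ?; apply: nS; exists S.
have H2 S : I03 t2 S -> I03 t1 S -> I03 s' S -> False.
  by move=> ? ? _; apply: nt; exists S.
have [S1 [S2 [p [P1 [P2 [[sS1 t1S1 t2S2 sS2'] [[pP1 P1S0 P1S1 [pP2 P2S0 P2S2]] [_ tp nom]]]]]]]] :=
  fork t1S0 sS0' (colC st1') st1 (colC st2') H1 H2.
have t2S1 : ~ I03 t2 S1 by move=> h; apply: nt; exists S1.
have [S3 [R [k [[_ _ RS1] [kR sk tk]]]]] := project_point HM sS1 t2S1 (colC st2).
have pS1 := point_plane_symp pP1 P1S1; have pS2 := point_plane_symp pP2 P2S2.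
have [j jk pj] := col_proj HM pS1 (ex_intro2 _ _ R kR RS1 : I13 k S1).
have jS1 : I03 j S1 by exists k => //; exists R.
have jS2 : I03 j S2 by apply: (symp_convex t2S2 pS2 tp (colC (tk _ jk)) (colC pj)).
have S12 : S1 <> S2 by move=> E; apply: t2S1; rewrite E.
have pj' : p <> j by move=> E; apply: tp; rewrite E; apply: tk.
have [N [Q [pN _ NQ QS1 QS2]]] := two_points_two_symps HM pj' S12 pS1 jS1 pS2 jS2.
have pQ : I02 p Q by exists N.
have [m [_ mS0 mS1 mS2]] := three_adjacent HM pP1 pP2 pQ P1S0 P1S1 P2S0 P2S2 QS1 QS2.
exact: nom mS0 mS1 mS2.
Qed.

(** Some line of [S] consists of points collinear to [x]; one of them is collinear
    to [y]. *)
Lemma col_near_symp x p y S : I03 p S -> I03 y S -> col x p ->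
  exists2 v, col x v & col y v.
Proof.
move=> pS yS xp.
have [k kS xk] : exists2 k, I13 k S & col_line I01 x k.
  have [xS|xS] := EM (I03 x S).
    by have [k xk kS] := xS; exists k => // w wk; exists k.
  have [S1 [P [k [[_ _ PS] [kP _ xk]]]]] := project_point HM pS xS xp.
  by exists k => //; exists P.
by have [v vk yv] := col_proj HM yS kS; exists v => //; apply: xk.
Qed.

Lemma two_neighbours x y : x <> y -> cosymp x y -> exists u v,
  [/\ u <> v, u <> x, u <> y & [/\ v <> x & v <> y]] /\
  [/\ col x u, col y u, col x v & col y v].
Proof.
move=> xy [S xS yS]; have HS := polar_at_symp HM xS.
have [[L xL yL]|nxy] := EM (col x y).
  have LS := line_in_symp HM xy xL yL xS yS.
  case: (LS) => P LP PS.
  have [v vP vL] := point_off_line HS PS LS.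
  have [u [uL ux uy]] : exists u, [/\ I01 u L, u <> x & u <> y].
    have [a [b [c [[ab ac bc] [aL bL cL]]]]] := polar_thick HS LS.
    have [ax|ax] := EM (a = x).
      have [b_y|b_y] := EM (b = y); first by exists c; split => //; congruence.
      by exists b; split => //; congruence.
    have [ay|ay] := EM (a = y); last by exists a.
    have [b_x|b_x] := EM (b = x); first by exists c; split => //; congruence.
    by exists b; split => //; congruence.
  exists u, v; split.
    by split=> //; [move=> E; apply: vL; rewrite -E|split=> E; apply: vL; rewrite E].
  have [xP yP] : I02 x P /\ I02 y P by split; exists L.
  by split; [exists L|exists L|apply: (plane_col HM xP vP)|apply: (plane_col HM yP vP)].
have [L xL [P LP PS]] := xS.
have xP : I02 x P by exists L.
have [k kP yk] := col_line_in_plane HM yS PS.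
have [u [v [_ [[uv _ _] [uk vk _]]]]] := polar_thick HS (ex_intro2 _ _ P kP PS : I13 k S).
have kk w : I01 w k -> [/\ w <> x, w <> y, col x w & col y w].
  move=> wk; have yw := yk w wk.
  have xw : col x w by apply: (plane_col HM xP); exists k.
  by split => // E; apply: nxy; [apply: colC|]; rewrite -{1}E.
have [? ? ? ?] := kk u uk; have [? ? ? ?] := kk v vk.
by exists u, v; do !split.
Qed.

(** Take neighbours [e] of [a] in [P1] and [h] of [c] in [P2] that are collinear.
    A point [w] of [B] is collinear to [e] and [c], as is [h], so [e] and [c] lie in
    a symp [D], which contains [h] by convexity.  Now [D], [S] and [S2] are pairwise
    adjacent, and the line they share is [l], the set of points of [P2]
    collinear to [c].  Hence [e] is collinear to all of [l], but it was chosen not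
    to be. *)
Lemma no_bridge S1 S2 S B P1 P2 a c :
  (forall x, I03 x S1 -> I03 x S2 -> False) ->
  I23 P1 S1 -> I23 P1 S -> I23 P2 S2 -> I23 P2 S ->
  I03 a S1 -> ~ I03 a S -> I03 c S2 -> ~ I03 c S ->
  I03 a B -> I03 c B -> ~ col a c ->
  (forall x, I03 x B -> I03 x S1 -> x = a) ->
  (forall x, I03 x B -> I03 x S2 -> x = c) -> False.
Proof.
move=> dis P1S1 P1S P2S2 P2S aS1 aS cS2 cS aB cB ac B1 B2.
have [k kP1 ak] := col_line_in_plane HM aS1 P1S1.
have [l lP2 cl] := col_line_in_plane HM cS2 P2S2.
have kS : I13 k S by exists P1.
have lS : I13 l S by exists P2.
have kS1 : I13 k S1 by exists P1.
have lS2 : I13 l S2 by exists P2.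
have kin w : I01 w k -> I03 w S /\ I03 w S1 by move=> wk; split; exists k.
have lin w : I01 w l -> I03 w S /\ I03 w S2 by move=> wl; split; exists l.
(* The planes P1 and P2 of S are disjoint, so k is not collinear to all of l. *)
have [e [h' [ek hl' eh']]] : exists e h', [/\ I01 e k, I01 h' l & ~ col e h'].
  apply: contrapT => H.
  have kl w : I01 w k -> col_line I01 w l.
    by move=> wk v vl; apply: contrapT => wv; apply: H; exists w, v.
  case: (kS) => P kP _; have [[e ek] _] := flag_extend HM kP.
  have [d de dk] := line_other HM ek.
  have [eS eS1] := kin e ek; have [dS dS1] := kin d dk.
  have [Q [QS lQ eQ]] := col_span HM eS lS (kl e ek).
  have dQ : I02 d Q.
    apply: (col_plane HM dS QS lQ (kl d dk) eQ); last by exists k.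
    by move=> el; have [_ eS2] := lin e el; apply: (dis e).
  have [w wk wl] := lines_meet HM (line_plane HM de dk ek dQ eQ) lQ.
  by have [_ ?] := kin w wk; have [_ ?] := lin w wl; apply: (dis w).
have [eS eS1] := kin e ek; have [hS' hS2'] := lin h' hl'.
have [h hl eh] := col_proj HM eS lS.
have [hS hS2] := lin h hl.
have eB : ~ I03 e B by move=> eB; apply: aS; rewrite -(B1 e).
have hB : ~ I03 h B by move=> hB; apply: cS; rewrite -(B2 h).
have [B' [R [j [[_ _ RB] [jR aj ej]]]]] := project_point HM aB eB (colC (ak e ek)).
have jB : I13 j B by exists R.
have [w wj cw] := col_proj HM cB jB.
have wh : w <> h by move=> E; apply: hB; rewrite -E; exists j.
have ec : e <> c by move=> E; apply: cS; rewrite -E.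
have eh2 : e <> h by move=> E; apply: (dis e) => //; rewrite E.
have ch2 : c <> h by move=> E; apply: cS; rewrite E.
have [D eD cD] := quadrangle wh (colC (ej w wj)) (colC cw) (colC eh) (colC (cl h hl)) ec.
have nec : ~ col e c.
  by move=> ec'; apply: cS; apply: (symp_convex eS hS' eh' (colC ec') (cl h' hl')).
have hD : I03 h D := symp_convex eD cD nec (colC eh) (colC (cl h hl)).
have DS : D <> S by move=> E; apply: cS; rewrite -E.
have DS2 : D <> S2 by move=> E; apply: (dis e) => //; rewrite -E.
have SS2 : S <> S2 by move=> E; apply: cS; rewrite E.
have [N [Q [_ hN NQ QD QS]]] := two_points_two_symps HM eh2 DS eD hD eS hS.
have [N' [Q' [_ hN' NQ' QD' QS2']]] := two_points_two_symps HM ch2 DS2 cD hD cS2 hS2.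
have [m [hm mD mS mS2]] := three_adjacent HM (line_on_plane hN NQ) (line_on_plane hN' NQ')
  (line_on_plane hl lP2) QD QS QD' QS2' P2S P2S2.
have ml w' : I01 w' m -> I01 w' l.
  move=> wm; apply: contrapT => wl; apply: cS; apply: (point_plane_symp _ P2S).
  have [wD wS wS2] : [/\ I03 w' D, I03 w' S & I03 w' S2] by split; exists m.
  apply: (col_plane HM cS2 P2S2 lP2 cl _ wl).
    exact: adjacent_inter SS2 P2S P2S2 wS wS2.
  exact: col_two_symps DS2 cD wD cS2 wS2.
have [g gh gm] := line_other HM hm.
have lm : l = m by apply: (line_uniq HM gh); rewrite //; apply: ml.
apply: eh'; apply: (col_two_symps HM DS eD _ eS hS').
by exists m => //; rewrite -lm.
Qed.

End Convexity.

Lemma adjacent_two_common T (I01 I12 I23 : T -> T -> Prop)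
    (HM : metasymp I01 I12 I23) S1 S2 T1 T2 :
  S1 <> S2 -> T1 <> T2 -> adjacent I23 S1 T1 -> adjacent I23 S1 T2 ->
  adjacent I23 S2 T1 -> adjacent I23 S2 T2 ->
  exists2 x, point_symp I01 I12 I23 x T1 & point_symp I01 I12 I23 x T2.
Proof.
move=> SS TT h1 h2 h3 h4.
have [x] := quadrangle (metasymp_dual HM) SS h1 h2 h3 h4 TT.
by rewrite !(point_symp_dual I01 I12 I23); exists x.
Qed.

Lemma two_adjacent T (I01 I12 I23 : T -> T -> Prop)
    (HM : metasymp I01 I12 I23) x S1 S2 : S1 <> S2 ->
  point_symp I01 I12 I23 x S1 -> point_symp I01 I12 I23 x S2 ->
  exists U V, [/\ U <> V, U <> S1, U <> S2 & [/\ V <> S1 & V <> S2]] /\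
  [/\ adjacent I23 S1 U, adjacent I23 S2 U, adjacent I23 S1 V & adjacent I23 S2 V].
Proof.
move=> SS xS1 xS2; apply: (two_neighbours (metasymp_dual HM) SS).
by exists x; rewrite !(point_symp_dual I01 I12 I23).
Qed.

Local Open Scope classical_set_scope.
Local Open Scope card_scope.

(** * From pregeometries to flag geometries *)

Lemma card_ge_family (T : Type) (A : set T) n : `I_n #<= A ->
  exists f : 'I_n -> T, injective f /\ forall i, A (f i).
Proof.
move=> /card_leP[f].
exists (fun i : 'I_n => val (f (exist _ (val i) (mem_set (ltn_ord i : `I_n i))))).
split=> [i j /val_inj E|i]; last exact: set_mem (valP _).
have [] := 'inj_f (mem_set I) (mem_set I) E.
exact: val_inj.
Qed.

Lemma three_points (T : Type) (A : set T) : `I_3 #<= A -> exists a b c,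
  [/\ a <> b, a <> c & b <> c] /\ [/\ A a, A b & A c].
Proof.
move=> /card_ge_family[f [fi fA]].
exists (f (inord 0)), (f (inord 1)), (f (inord 2)); split; last by split.
by split=> /fi /(congr1 (@nat_of_ord 3)); rewrite !inordK.
Qed.

Lemma three_points_option (T S : Type) (A : set T) :
  `I_2 #<= [set: S] -> A #= [set: option S] -> exists a b c,
  [/\ a <> b, a <> c & b <> c] /\ [/\ A a, A b & A c].
Proof.
move=> /card_ge_family[f [fi _]] /card_esym/card_eqP[g].
pose h (o : option S) := val (g (exist _ o (mem_set (I : [set: option S] o)))).
have hi o o' : h o = h o' -> o = o'.
  by move=> /val_inj E; have [] := 'inj_g (mem_set I) (mem_set I) E.
have hA o : A (h o) by exact: set_mem (valP _).
exists (h None), (h (Some (f ord0))), (h (Some (f ord_max))); split => //.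
by split=> /hi // -[/fi].
Qed.

Lemma geometry_incident T (G : pregeometry T) i j u v : geometry G ->
  (i < rank G)%N -> (j < rank G)%N -> elts G i u -> elts G j v ->
  incident G u v ->
  exists c, [/\ chambers G c, onth c i = Some u & onth c j = Some v].
Proof.
case=> dis _ ch ir jr ui vj [c [i' [j' [cG _ cu cv]]]].
have [sz el] := ch c cG.
have typ k l w : (k < rank G)%N -> elts G k w -> onth c l = Some w -> l = k.
  move=> kr wk cw; apply: contrapT => lk.
  have lr : (l < rank G)%N by rewrite -sz -onthTE cw.
  by have : (elts G l `&` elts G k) w; [split => //; exact: el cw|rewrite dis].
by exists c; rewrite -{1}(typ i i' u ir ui cu) -(typ j j' v jr vj cv).
Qed.

Lemma incidentC T (G : pregeometry T) u v : incident G u v -> incident G v u.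
Proof. by case=> c [i [j [? ? ? ?]]]; exists c, j, i; split => //; apply: nesym. Qed.

Lemma chamber_incident T (G : pregeometry T) c i j u v : chambers G c ->
  onth c i = Some u -> onth c j = Some v -> i <> j -> incident G u v.
Proof. by move=> ? ? ? ?; exists c, i, j. Qed.

Section PolarSpace.
Variables (T : Type) (G : pregeometry T).
Hypothesis HG : polar_space3 G.

Let r3 : rank G = 3 := polar_rank HG.
Let geo := polar_geometry HG.

Lemma polar_incident_chamber i j u v : (i < 3)%N -> (j < 3)%N ->
  elts G i u -> elts G j v -> incident G u v ->
  exists p L P, [/\ chambers G [:: p; L; P], onth [:: p; L; P] i = Some u
    & onth [:: p; L; P] j = Some v].
Proof.
move=> ir jr ui vj uv; have := geometry_incident geo _ _ ui vj uv.
rewrite r3 => /(_ ir jr)[c [cG cu cv]].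
case: geo => _ _ ch; have [] := ch _ cG; rewrite r3.
by case: c cG cu cv => [|p [|L [|P []]]] //; exists p, L, P.
Qed.

Lemma polar_line_pt L : lines G L -> exists a b c,
  [/\ a <> b, a <> c & b <> c] /\ [/\ pts G L a, pts G L b & pts G L c].
Proof. by move=> HL; apply: three_points; apply: polar_thick_lines. Qed.

Lemma polar_incident_sub L P : lines G L -> planes G P ->
  incident G L P <-> pts G L `<=` pts G P.
Proof.
move=> HL HP; split=> [LP|LP].
  have [p [L' [P' [cG /= [EL] [EP]]]]] := @polar_incident_chamber 1 2 _ _ isT isT HL HP LP.
  by move: cG; rewrite EL EP => /(polar_chambers HG)[].
have [p [_ [_ [_ [pL _ _]]]]] := polar_line_pt HL.
apply: (@chamber_incident _ _ [:: p; L; P] 1 2) => //.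
exact/(polar_chambers HG).
Qed.

Lemma polar_pts_plane p P : planes G P -> pts G P p <->
  exists L, [/\ lines G L, pts G L p & incident G L P].
Proof.
move=> HP; split=> [[Hp pP]|[L [HL pL /polar_incident_sub]]]; last by apply.
have [p' [L [P' [cG /= [Ep] [EP]]]]] := @polar_incident_chamber 0 2 _ _ isT isT Hp HP pP.
move: cG; rewrite Ep EP => /(polar_chambers HG)[HL _ pL LP].
by exists L; split => //; apply/polar_incident_sub.
Qed.

Lemma line_singular L : lines G L -> singular_subspace G (pts G L).
Proof.
move=> HL; have : (pts G @` lines G) (pts G L) by exists L.
by rewrite (polar_lines HG) => -[[]].
Qed.

Lemma plane_maximal P : planes G P -> maximal_singular G (pts G P).
Proof.
move=> HP; have : (pts G @` planes G) (pts G P) by exists P.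
by rewrite (polar_maximal HG).
Qed.

Lemma collinearC x y : collinear G x y -> collinear G y x.
Proof. by case=> L HL [? ?]; exists L. Qed.

Lemma collinear_all p L q r : points G p -> lines G L -> q <> r ->
  pts G L q -> pts G L r -> collinear G p q -> collinear G p r ->
  forall y, pts G L y -> collinear G p y.
Proof.
move=> Hp HL qr qL rL pq pr y yL.
have [pL|pL] := EM (incident G p L); first by exists L => //; do !split; case: yL.
have [[z [_ Hz]]|] := polar_one_or_all HG Hp HL pL; last by apply.
by case: qr; rewrite -(Hz q) // -(Hz r).
Qed.

Lemma collinear_proj p L : points G p -> lines G L ->
  exists2 q, pts G L q & collinear G p q.
Proof.
move=> Hp HL.
have [pL|pL] := EM (incident G p L).
  by exists p; [|exists L].
have [[z [[zL pz] _]]|H] := polar_one_or_all HG Hp HL pL; first by exists z.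
have [a [_ [_ [_ [aL _ _]]]]] := polar_line_pt HL.
by exists a => //; apply: H.
Qed.

(** The points collinear to all of [C]; no point being required to lie on a
    line, equality is allowed for explicitly. *)
Definition common_perp (C : set T) : set T :=
  [set q | points G q /\ forall c, C c -> q = c \/ collinear G q c].

Lemma common_perp_line C L x y : lines G L -> C `<=` points G ->
  common_perp C x -> common_perp C y ->
  x <> y -> pts G L x -> pts G L y -> pts G L `<=` common_perp C.
Proof.
move=> HL CP [_ xC] [_ yC] xy xL yL z zL; split; first by case: zL.
have near u c : pts G L u -> (u = c \/ collinear G u c) -> collinear G c u.
  by move=> uL [<-|/collinearC//]; exists L.
move=> c Cc; right; apply/collinearC.
by apply: (collinear_all (CP c Cc) HL xy xL yL _ _ zL); apply: near; auto.
Qed.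

(** The double perp of a clique is a singular subspace containing it. *)
Lemma clique_singular C : C `<=` points G ->
  (forall x y, C x -> C y -> x <> y -> collinear G x y) ->
  exists2 X, singular_subspace G X & C `<=` X.
Proof.
move=> CP clq; exists (common_perp (common_perp C)).
  have sub : C `<=` common_perp C.
    move=> x Cx; split; first exact: CP.
    by move=> c Cc; have [->|xc] := EM (x = c); [left|right; apply: clq].
  split=> [x []//|x y [Hx xC] [Hy yC] xy|L x y HL Cx Cy xy xL yL].
    have Cy : common_perp C y.
      by split => // c /sub Cc; exact: yC.
    by case: (xC y Cy).
  by apply: common_perp_line HL _ Cx Cy xy xL yL => z [].
move=> x Cx; split; first exact: CP.
move=> c [_ /(_ x Cx)[->|/collinearC]]; [by left|by right].
Qed.

(** Zorn's lemma, applied to the sets whose union with [X] is singular, so that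
    the empty chain causes no trouble. *)
Lemma singular_maximal X : singular_subspace G X ->
  exists2 P, planes G P & X `<=` pts G P.
Proof.
move=> HX.
have [|A [HA Amax]] := @Zorn_bigcup T [set Y | singular_subspace G (X `|` Y)].
  move=> F FP tot; rewrite /=; set U := X `|` _.
  have dir x y : U x -> U y -> exists Y,
      [/\ singular_subspace G (X `|` Y), X `|` Y `<=` U, (X `|` Y) x & (X `|` Y) y].
    have UF Y : F Y -> X `|` Y `<=` U.
      by move=> FY z [?|?]; [left|right; exists Y].
    case=> [Xx|[Y FY Yx]] [Xy|[Z FZ Zy]].
    - exists set0; rewrite setU0; split => //; exact: subsetUl.
    - by exists Z; split; [exact: FP|exact: UF|left|right].
    - by exists Y; split; [exact: FP|exact: UF|right|left].
    - have [YZ|ZY] := tot Y Z FY FZ.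
        by exists Z; split; [exact: FP|exact: UF|right; apply: YZ|right].
      by exists Y; split; [exact: FP|exact: UF|right|right; apply: ZY].
  split=> [x Ux|x y Ux Uy|L x y HL Ux Uy].
  - by have [Y [[sub _ _] _ Yx _]] := dir x x Ux Ux; apply: sub.
  - by have [Y [[_ clq _] _ Yx Yy]] := dir x y Ux Uy; apply: clq.
  - have [Y [[_ _ lin] YU Yx Yy]] := dir x y Ux Uy.
    by move=> xy xL yL z zL; apply: YU; apply: (lin L x y).
have max : maximal_singular G (X `|` A).
  split => // Z HZ XAZ; apply: contrapT => ZXA.
  apply: (Amax Z); last first.
    by rewrite /= (_ : X `|` Z = Z) //; apply/setUidPr => x Xx; apply: XAZ; left.
  split=> [x Ax|E]; first by apply: XAZ; right.
  by apply: ZXA; apply/seteqP; split => // x /E; right.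
have : [set Y | maximal_singular G Y] (X `|` A) by [].
rewrite -(polar_maximal HG) => -[P HP PE].
by exists P => //; rewrite PE; exact: subsetUl.
Qed.

Lemma plane_max p P : points G p -> planes G P ->
  (forall q, pts G P q -> collinear G p q) -> pts G P p.
Proof.
move=> Hp HP pP; have [[sub clq _] max] := plane_maximal HP.
have [||Y HY PY] := @clique_singular (p |` pts G P).
- by move=> x [->//|]; exact: sub.
- by move=> x y [->|Px] [->|Py] // ?; auto using collinearC.
by rewrite -(max Y HY (subset_trans (@subsetUr _ _ _) PY)); apply: PY; left.
Qed.

(** The points of [P] collinear to [p] form a singular subspace that contains [L]
    properly; if it were not all of [P], it would yield a chain of singular
    subspaces making the dimension of [P] at least 3. *)
Lemma plane_hyp p P L f : points G p -> planes G P -> lines G L ->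
  pts G L `<=` pts G P -> (forall q, pts G L q -> collinear G p q) ->
  pts G P f -> ~ pts G L f -> collinear G p f ->
  forall q, pts G P q -> collinear G p q.
Proof.
move=> Hp HP HL LP pL fP fL pf.
pose X := [set q | pts G P q /\ collinear G p q].
have [[sub clq lin] _] := plane_maximal HP.
have HX : singular_subspace G X.
  split=> [x [/sub]//|x y [xP _] [yP _]|N x y HN [xP px] [yP py] xy xN yN z zN].
    exact: clq.
  split; first exact: (lin N x y).
  exact: (collinear_all Hp HN xy xN yN).
have : (pts G @` planes G) (pts G P) by exists P.
rewrite (polar_planes HG) => -[_ n3].
have : (pts G @` lines G) (pts G L) by exists L.
rewrite (polar_lines HG) => -[d1 _].
apply: contrapT => H; apply: n3; split; first by case: (plane_maximal HP).
exists X.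
  by split=> [x []//|PX]; apply: H => q /PX[].
split => //; exists (pts G L) => //.
split=> [x xL|XL]; first by split; [exact: LP|exact: pL].
by apply: fL; apply: XL.
Qed.

(** A chain of subspaces of [P] gives three points not on a line; one of the three
    lines joining them misses [a]. *)
Lemma plane_off P a : planes G P -> exists L,
  [/\ lines G L, pts G L `<=` pts G P & ~ pts G L a].
Proof.
move=> HP; have : (pts G @` planes G) (pts G P) by exists P.
rewrite (polar_planes HG) => -[/= [HS [X1 [X1P nPX1] [HX1 [X0 [X01 nX10] [HX0 [p0 Xp0]]]]]] _].
have [p1 [Xp1 Xp01]] : exists p1, X1 p1 /\ ~ X0 p1.
  by apply: contrapT => H; apply: nX10 => x X1x; apply: contrapT => X0x; apply: H; exists x.
have [p2 [Pp2 Xp12]] : exists p2, pts G P p2 /\ ~ X1 p2.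
  by apply: contrapT => H; apply: nPX1 => x X1x; apply: contrapT => X0x; apply: H; exists x.
have [_ clq lin] := HS; have [_ _ lin1] := HX1.
have p01 : p0 <> p1 by move=> E; apply: Xp01; rewrite -E.
have p02 : p0 <> p2 by move=> E; apply: Xp12; rewrite -E; apply: X01.
have p12 : p1 <> p2 by move=> E; apply: Xp12; rewrite -E.
have [P0 P1] : pts G P p0 /\ pts G P p1 by split; apply: X1P => //; apply: X01.
have [L HL [L0 L1]] := clq _ _ P0 P1 p01.
have [M HM [M0 M2]] := clq _ _ P0 Pp2 p02.
have [N HN [N1 N2]] := clq _ _ P1 Pp2 p12.
have LX : pts G L `<=` X1 := lin1 L p0 p1 HL (X01 _ Xp0) Xp1 p01 L0 L1.
have [aL|aL] := EM (pts G L a); last first.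
  by exists L; split => //; exact: (lin L p0 p1).
have [ap|ap] := EM (a = p1); last first.
  exists N; split => //; first exact: (lin N p1 p2).
  move=> aN; apply: Xp12; apply: (lin1 N a p1) => //; exact: LX.
exists M; split => //; first exact: (lin M p0 p2).
move=> aM; apply: Xp12; apply: (lin1 M a p0) => //; first exact: LX.
  exact: X01.
by rewrite ap => /esym.
Qed.

End PolarSpace.

(** A polar space of rank 3, presented through predicates that agree with its
    point, line and plane sets. *)
Lemma polar_of_space (T : Type) (G : pregeometry T) (HG : polar_space3 G)
    (Pt Ln Pl : T -> Prop) (J01 J12 : T -> T -> Prop) :
  (forall p, Pt p <-> points G p) -> (forall L, Ln L <-> lines G L) ->
  (forall P, Pl P <-> planes G P) ->
  (forall p L, lines G L -> (J01 p L <-> pts G L p)) ->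
  (forall L P, planes G P -> (J12 L P <-> lines G L /\ incident G L P)) ->
  polar Pt Ln Pl J01 J12.
Proof.
move=> hPt hLn hPl h01 h12.
have h02 p P : planes G P -> (relcomp J01 J12 p P <-> pts G P p).
  move=> HP; split=> [[L pL /(h12 L P HP)[HL LP]]|/(polar_pts_plane HG p HP)[L [HL pL LP]]].
    by apply/(polar_pts_plane HG p HP); exists L; split => //; apply/h01.
  by exists L; [apply/h01|apply/h12].
have hperp p q : perp Ln J01 p q <-> collinear G p q.
  split=> [[L [/hLn HL /(h01 _ _ HL) pL /(h01 _ _ HL) qL]]|[L HL [pL qL]]].
    by exists L.
  by exists L; split; [exact/hLn|exact/h01|exact/h01].
have h12' L P : planes G P -> lines G L -> (J12 L P <-> pts G L `<=` pts G P).
  move=> HP HL; split=> [/(h12 _ _ HP)[_ ?]|LP]; first exact/(polar_incident_sub HG HL HP).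
  by apply/h12 => //; split => //; apply/(polar_incident_sub HG).
split.
- by move=> L P /hPl HP /(h12 L P HP)[/hLn].
- by move=> p L /hLn HL /(h01 _ _ HL)[? _]; apply/hPt.
- move=> L L' p q /hLn HL /hLn HL' pq /(h01 _ _ HL) pL /(h01 _ _ HL) qL.
  move=> /(h01 _ _ HL') pL' /(h01 _ _ HL') qL'.
  have [_ _ sub] := line_singular HG HL; have [_ _ sub'] := line_singular HG HL'.
  apply: (polar_determined HG (i := 1)) => //; first by rewrite (polar_rank HG).
  by apply/seteqP; split; [exact: (sub' L p q)|exact: (sub L' p q)].
- move=> P p q /hPl HP pq /(h02 _ _ HP) pP /(h02 _ _ HP) qP.
  have [[_ clq lin] _] := plane_maximal HG HP.
  have [L HL [pL qL]] := clq p q pP qP pq.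
  exists L; split; [|exact/h01|exact/h01].
  by apply/h12' => //; apply: (lin L p q).
- move=> p L /hPt Hp /hLn HL.
  have [q qL pq] := collinear_proj HG Hp HL.
  by exists q; [exact/h01|exact/hperp].
- move=> p L q r /hPt Hp /hLn HL qr /(h01 _ _ HL) qL /(h01 _ _ HL) rL /hperp pq /hperp pr.
  by move=> y /(h01 _ _ HL) yL; apply/hperp; apply: (collinear_all HG Hp HL qr).
- move=> p P /hPt Hp /hPl HP pP; apply/h02 => //; apply: (plane_max HG) => // q qP.
  by apply/hperp; apply: pP; apply/h02.
- move=> p P L f /hPt Hp /hPl HP /(h12 _ _ HP)[HL /(polar_incident_sub HG HL HP) LP].
  move=> pL /(h02 _ _ HP) fP fL /hperp pf q /(h02 _ _ HP) qP; apply/hperp.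
  apply: (plane_hyp HG Hp HP HL LP _ fP _ pf) => //.
    by move=> r rL; apply/hperp; apply: pL; apply/h01.
  by move=> /(h01 _ _ HL).
- move=> a b c /hPt Ha /hPt Hb /hPt Hc /hperp ab /hperp ac /hperp bc.
  have [||X HX CX] := @clique_singular _ G HG [set x | [\/ x = a, x = b | x = c]].
  + by move=> x [->|->|->].
  + by move=> x y [->|->|->] [->|->|->] // _; auto using collinearC.
  have [P HP XP] := singular_maximal HG HX.
  exists P; split; [exact/hPl| | |]; apply/h02 => //; apply: XP; apply: CX.
  + exact: Or31.
  + exact: Or32.
  + exact: Or33.
- move=> P a /hPl HP; have [L [HL LP aL]] := plane_off HG a HP.
  by exists L; [apply/h12'|move=> /(h01 _ _ HL)].
- move=> L /hLn HL; have [a [b [c [ne [? ? ?]]]]] := polar_line_pt HG HL.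
  by exists a, b, c; split => //; split; apply/h01.
- move=> P P' /hPl HP /hPl HP' sub.
  apply: (polar_determined HG (i := 2)) => //; first by rewrite (polar_rank HG).
  have [_ max] := plane_maximal HG HP; have [HP'1 _] := plane_maximal HG HP'.
  by apply: esym; apply: max => // x /(h02 _ _ HP) /sub /(h02 _ _ HP').
Qed.

Section MetasymplecticSpace.
Variables (T : Type) (M : pregeometry T).
Hypothesis HM : metasymplectic M.

Let r4 : rank M = 4 := ms_rank HM.
Let geo := ms_geometry HM.

Definition point_line p L := lines M L /\ pts M L p.
Definition line_plane_inc L P := [/\ lines M L, planes M P & incident M L P].
Definition plane_symp P S := [/\ planes M P, symps M S & incident M P S].

Local Notation I01 := point_line.
Local Notation I12 := line_plane_inc.
Local Notation I23 := plane_symp.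
Local Notation I02 := (relcomp I01 I12).
Local Notation I13 := (relcomp I12 I23).
Local Notation I03 := (point_symp I01 I12 I23).

Lemma ms_incident_chamber i j u v : (i < 4)%N -> (j < 4)%N ->
  elts M i u -> elts M j v -> incident M u v ->
  exists p L P S, [/\ chambers M [:: p; L; P; S], onth [:: p; L; P; S] i = Some u
    & onth [:: p; L; P; S] j = Some v].
Proof.
move=> ir jr ui vj uv; have := geometry_incident geo _ _ ui vj uv.
rewrite r4 => /(_ ir jr)[c [cG cu cv]].
case: geo => _ _ ch; have [] := ch _ cG; rewrite r4.
by case: c cG cu cv => [|p [|L [|P [|S []]]]] //; exists p, L, P, S.
Qed.

Lemma chamber_flags p L P S :
  chambers M [:: p; L; P; S] <-> [/\ I01 p L, I12 L P & I23 P S].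
Proof.
split=> [cM|[[HL pL] [_ HP LP] [_ HS PS]]].
  have [_ _ /(_ _ cM)[_ el]] := geo.
  have [pM LM PM SM] : [/\ points M p, lines M L, planes M P & symps M S].
    by split; [exact: (el 0)|exact: (el 1)|exact: (el 2)|exact: (el 3)].
  have inc i j u v := @chamber_incident _ M [:: p; L; P; S] i j u v cM.
  split.
  - by split => //; split => //; apply: (inc 0 1).
  - by split => //; apply: (inc 1 2).
  - by split => //; apply: (inc 2 3).
apply/(ms_chambers HM); split=> //; split => //.
- have [p' [L' [P' [S' [/(ms_chambers HM)[_ [_ sub _]] /= [E] [E']]]]]] :=
    @ms_incident_chamber 1 2 L P isT isT HL HP LP.
  by rewrite -E -E'.
- have [p' [L' [P' [S' [/(ms_chambers HM)[_ [_ _ sub]] /= [E] [E']]]]]] :=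
    @ms_incident_chamber 2 3 P S isT isT HP HS PS.
  by rewrite -E -E'.
Qed.

Lemma line_plane_chamber L P : I12 L P -> exists p S, chambers M [:: p; L; P; S].
Proof.
case=> HL HP LP; have [p' [L' [P' [S' [c /= [E] [E']]]]]] :=
  @ms_incident_chamber 1 2 L P isT isT HL HP LP.
by exists p', S'; rewrite -E -E'.
Qed.

Lemma point_line_chamber p L : I01 p L -> exists P S, chambers M [:: p; L; P; S].
Proof.
case=> HL [Hp pL]; have [p' [L' [P' [S' [c /= [E] [E']]]]]] :=
  @ms_incident_chamber 0 1 p L isT isT Hp HL pL.
by exists P', S'; rewrite -E -E'.
Qed.

Lemma plane_symp_chamber P S : I23 P S -> exists p L, chambers M [:: p; L; P; S].
Proof.
case=> HP HS PS; have [p' [L' [P' [S' [c /= [E] [E']]]]]] :=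
  @ms_incident_chamber 2 3 P S isT isT HP HS PS.
by exists p', L'; rewrite -E -E'.
Qed.

Lemma chamber_elts p L P S : chambers M [:: p; L; P; S] ->
  [/\ points M p, lines M L, planes M P & symps M S].
Proof. by move=> /chamber_flags[[? [? _]] [_ ? _] [_ ? _]]. Qed.

Lemma point_planeE p P : I02 p P <-> planes M P /\ pts M P p.
Proof.
split=> [[L pL LP]|[HP [Hp pP]]].
  have [q [S cM]] := line_plane_chamber LP; case: (LP) => _ HP _; split => //.
  case/(ms_chambers HM): cM => _ [_ sub _]; case: pL => _; exact: sub.
have [p' [L [P' [S [c /= [E] [E']]]]]] := @ms_incident_chamber 0 2 p P isT isT Hp HP pP.
by move: c; rewrite E E' => /chamber_flags[? ? _]; exists L.
Qed.

Lemma line_sympE L S : I13 L S <-> [/\ lines M L, symps M S & incident M L S].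
Proof.
split=> [[P LP PS]|[HL HS LS]].
  have [q [S' /chamber_flags[qL _ _]]] := line_plane_chamber LP.
  have c : chambers M [:: q; L; P; S] by apply/chamber_flags.
  have [_ ? _ ?] := chamber_elts c; split => //.
  exact: (chamber_incident (i := 1) (j := 3) c).
have [p' [L' [P' [S' [c /= [E] [E']]]]]] := @ms_incident_chamber 1 3 L S isT isT HL HS LS.
by move: c; rewrite E E' => /chamber_flags[_ ? ?]; exists P'.
Qed.

Lemma point_sympE p S : I03 p S <-> symps M S /\ pts M S p.
Proof.
split=> [[L pL [P LP PS]]|[HS [Hp pS]]].
  have c : chambers M [:: p; L; P; S] by apply/chamber_flags.
  have [? _ _ ?] := chamber_elts c; split => //; split => //.
  exact: (chamber_incident (i := 0) (j := 3) c).
have [p' [L [P [S' [c /= [E] [E']]]]]] := @ms_incident_chamber 0 3 p S isT isT Hp HS pS.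
by move: c; rewrite E E' => /chamber_flags[? ? ?]; exists L => //; exists P.
Qed.

Lemma shadow_incident S i j u v : geometry (shadow M 3 S) ->
  (i < 3)%N -> (j < 3)%N -> i <> j ->
  elts (shadow M 3 S) i u -> elts (shadow M 3 S) j v ->
  incident (shadow M 3 S) u v <->
  exists p L P, [/\ chambers M [:: p; L; P; S], onth [:: p; L; P] i = Some u
    & onth [:: p; L; P] j = Some v].
Proof.
move=> gS ir jr ij ui vj; split=> [uv|[p [L [P [c cu cv]]]]].
  have [c [[c' [cM cS] <-] cu cv]] := geometry_incident gS ir jr ui vj uv.
  case: geo => _ _ ch; have [] := ch _ cM; rewrite r4.
  case: c' cM cS cu cv => [|p [|L [|P [|S' []]]]] //= cM [<-] cu cv _ _.
  by exists p, L, P.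
apply: (chamber_incident _ cu cv ij).
by exists [:: p; L; P; S].
Qed.

Lemma residue_incident x i j u v : geometry (dual (residue M 0 x)) ->
  (i < 3)%N -> (j < 3)%N -> i <> j ->
  elts (dual (residue M 0 x)) i u -> elts (dual (residue M 0 x)) j v ->
  incident (dual (residue M 0 x)) u v <->
  exists L P S, [/\ chambers M [:: x; L; P; S], onth [:: S; P; L] i = Some u
    & onth [:: S; P; L] j = Some v].
Proof.
move=> gS ir jr ij ui vj; split=> [uv|[L [P [S [c cu cv]]]]].
  have [||c [[c0 [c' [cM cS] <-] <-] cu cv]] := geometry_incident gS _ _ ui vj uv;
    rewrite /= ?r4 //.
  case: geo => _ _ ch; have [] := ch _ cM; rewrite r4.
  case: c' cM cS cu cv => [|p [|L [|P [|S []]]]] //= cM [<-] cu cv _ _.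
  by exists L, P, S.
apply: (chamber_incident _ cu cv ij).
by exists [:: L; P; S] => //; exists [:: x; L; P; S].
Qed.

Lemma ms_symp_polar P0 S : I23 P0 S ->
  polar (fun p => I03 p S) (fun L => I13 L S) (fun P => I23 P S) I01 I12.
Proof.
case=> _ HS _; have HG := MS1 HM HS; have gG := polar_geometry HG.
have h0 p : I03 p S <-> points (shadow M 3 S) p.
  split=> [/point_sympE[_ [? ?]]//|[? ?]].
  by apply/point_sympE.
have h1 L : I13 L S <-> lines (shadow M 3 S) L.
  by split=> [/line_sympE[? _ ?]//|[? ?]]; apply/line_sympE.
have h2 P : I23 P S <-> planes (shadow M 3 S) P by split=> [[? ? ?]//|[? ?]].
apply: (polar_of_space HG) => // [p L HL|L P HP].
- split=> [pL|[Hp /(@shadow_incident S 0 1)]].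
    have [P LP PS] := (h1 L).2 HL.
    have c : chambers M [:: p; L; P; S] by apply/chamber_flags.
    have Hp : points (shadow M 3 S) p by apply/h0; exists L => //; exists P.
    by split => //; apply/(@shadow_incident S 0 1) => //; exists p, L, P.
  case=> // p' [L' [P [/chamber_flags[? _ _] /= [<-] [<-]]]] //.
- split=> [LP|[HL /(@shadow_incident S 1 2)]].
    have HL : lines (shadow M 3 S) L by apply/h1; exists P => //; apply/h2.
    split => //; have [q [S' /chamber_flags[qL _ _]]] := line_plane_chamber LP.
    have c : chambers M [:: q; L; P; S] by apply/chamber_flags; split => //; apply/h2.
    by apply/(@shadow_incident S 1 2) => //; exists q, L, P.
  by case=> // p' [L' [P' [/chamber_flags[_ ? _] /= [<-] [<-]]]].
Qed.

Lemma ms_point_polar x L0 : I01 x L0 ->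
  polar (fun S => I03 x S) (fun P => I02 x P) (fun L => I01 x L)
    (fun S P => I23 P S) (fun P L => I12 L P).
Proof.
case=> _ [Hx _]; have HG := MS2 HM Hx; have gG := polar_geometry HG.
set G := dual _ in HG gG.
have h0 S : I03 x S <-> points G S.
  rewrite /G /points /= r4; split=> [/point_sympE[? [_ ?]]//|[? ?]].
  by apply/point_sympE.
have h1 P : I02 x P <-> lines G P.
  rewrite /G /lines /= r4; split=> [/point_planeE[? [_ ?]]//|[? ?]].
  by apply/point_planeE.
have h2 L : I01 x L <-> planes G L.
  by rewrite /G /planes /= r4; split=> [[? [_ ?]]//|[? ?]].
apply: (polar_of_space HG) => // [S P HP|P L HL].
- split=> [PS|[HS /(@residue_incident x 0 1)]].
    have [L xL LP] := (h1 P).2 HP.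
    have c : chambers M [:: x; L; P; S] by apply/chamber_flags.
    have HS : points G S by apply/h0; exists L => //; exists P.
    by split => //; apply/(@residue_incident x 0 1) => //; exists L, P, S.
  by case=> // L' [P' [S' [/chamber_flags[_ _ ?] /= [<-] [<-]]]].
- split=> [LP|[HP /(@residue_incident x 1 2)]].
    have HP : lines G P by apply/h1; exists L => //; apply/h2.
    split => //; have [q [S /chamber_flags[_ _ PS]]] := line_plane_chamber LP.
    have c : chambers M [:: x; L; P; S] by apply/chamber_flags; split => //; apply/h2.
    by apply/(@residue_incident x 1 2) => //; exists L, P, S.
  by case=> // L' [P' [S' [/chamber_flags[_ ? _] /= [<-] [<-]]]].
Qed.

Lemma plane_sub_symp q P S : symps M S -> I02 q P -> pts M P `<=` pts M S -> I23 P S.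
Proof.
move=> HS [L qL LP] PS.
have [p [S' /(ms_chambers HM)[[? ? _] [_ sub _]]]] := line_plane_chamber LP.
have c : chambers M [:: q; L; P; S].
  by apply/(ms_chambers HM); split=> //; split => //; case: qL.
by have /chamber_flags[] := c.
Qed.

(** A plane without points would be isolated in the incidence graph. *)
Lemma plane_point P S : planes M P -> symps M S -> exists q, I02 q P.
Proof.
move=> HP HS; have elt i u : (i < 4)%N -> elts M i u -> elements M u.
  by move=> i4 ui; exists i; rewrite //= r4.
have [dis _ ch] := geo.
have typ i j u : (i < 4)%N -> (j < 4)%N -> elts M i u -> elts M j u -> i = j.
  move=> i4 j4 ui uj; apply: contrapT => ij.
  have : (elts M i `&` elts M j) u by split.
  by rewrite dis // r4.
have [[|n]] := ms_connected HM (elt 2 P isT HP) (elt 3 S isT HS).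
  by move=> /= PS; have := typ 2 3 P isT isT HP; rewrite {1}PS => /(_ HS).
case=> z [[c [i [j [cM _ ci _]]]] _]; have [sz el] := ch c cM.
have i4 : (i < 4)%N by rewrite -r4 -sz -onthTE ci.
have i2 := typ i 2 P i4 isT (el i P ci) HP.
move: sz cM ci; rewrite i2 r4.
case: c {el} => [|p [|L [|P' [|S' []]]]] //= _ /chamber_flags[pL LP _] [<-].
by exists p, L.
Qed.

Lemma plane_symp_sub P S : I23 P S -> pts M P `<=` pts M S.
Proof.
move=> PS p pP; have [HP _ _] := PS.
have /point_planeE pP' : planes M P /\ pts M P p by [].
by have /point_sympE[] := point_plane_symp pP' PS.
Qed.

(** Were a plane [P] contained in a line [L], it would be contained, hence
    incident with, a symp through [L], where planes and lines behave. *)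
Lemma plane_not_in_line P S L : I23 P S -> lines M L -> ~ pts M P `<=` pts M L.
Proof.
move=> PS HL PL; have [q [N /chamber_flags[qN NP _]]] := plane_symp_chamber PS.
have qP : I02 q P by exists N.
have P_L p : I02 p P -> I01 p L by move=> /point_planeE[_ /PL].
have [R [S' c]] := point_line_chamber (P_L q qP).
have [_ LR RS'] := (chamber_flags _ _ _ _).1 c.
have LS' : I13 L S' by exists R.
have PS' : I23 P S'.
  case: (RS') => _ HS' _; apply: (plane_sub_symp HS' qP).
  case/(ms_chambers HM): c => _ [_ LR' RS''].
  exact: subset_trans PL (subset_trans LR' RS'').
have H := ms_symp_polar PS'; have [K KP qK] := polar_off H q PS'.
have HK := polar_line_plane H PS' KP.
have [a [b [_ [[ab _ _] [aK bK _]]]]] := polar_thick H HK.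
apply: qK; rewrite (polar_line_uniq H HK LS' ab aK bK) //; apply: P_L => //;
  by exists K.
Qed.

Lemma common_plane_inter P S S' : S <> S' -> I23 P S -> I23 P S' ->
  exists Q, [/\ planes M Q, pts M S `&` pts M S' = pts M Q & pts M P `<=` pts M Q].
Proof.
move=> SS PS PS'; have [_ HS _] := PS; have [_ HS' _] := PS'.
have sub : pts M P `<=` pts M S `&` pts M S'.
  by move=> p pP; split; [exact: plane_symp_sub pP|exact: plane_symp_sub pP].
have [q [N /chamber_flags[qN NP _]]] := plane_symp_chamber PS.
have onP p : I01 p N -> pts M P p.
  by move=> pN; have /point_planeE[] : I02 p P by exists N.
have [E|[p _ E]|[L HL E]|[Q HQ E]] := MS3 HM HS HS' SS.
- by have := sub q (onP q qN); rewrite E.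
- have [r rq rN] := other_point (ms_symp_polar PS) q (ex_intro2 _ _ P NP PS : I13 N S).
  have := sub _ (onP r rN); have := sub _ (onP q qN).
  by rewrite E => /= qp rp; case: rq; rewrite qp rp.
- by case: (plane_not_in_line PS HL); rewrite -E.
- by exists Q; rewrite -E.
Qed.

(** If [L] is not incident with [S], the residue at [x] provides a symp [S']
    through [L] adjacent to [S].  Their intersection is a plane containing [x] and
    [y], and the line joining these two in it is [L]. *)
Lemma ms_line_in_symp x y L S : x <> y -> I01 x L -> I01 y L ->
  I03 x S -> I03 y S -> I13 L S.
Proof.
move=> xy xL yL xS yS; apply: contrapT => LS.
have HX := ms_point_polar xL.
have [R LR SR] := perp_line HX xS xL.
have xR : I02 x R by exists L.
have [S' [_ [_ [_ [RS' _ _]]]]] := polar_thick HX xR.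
have LS' : I13 L S' by exists R.
have [P [xP PS PS']] := SR S' RS'.
have SS : S <> S' by move=> E; apply: LS; rewrite E.
have [Q [HQ E PQ]] := common_plane_inter SS PS PS'.
have Qpt z : I03 z S -> I03 z S' -> I02 z Q.
  move=> /point_sympE[_ zS] /point_sympE[_ zS'].
  by apply/point_planeE; split => //; rewrite -E; split.
have xQ : I02 x Q by apply: Qpt => //; exists L.
have yQ : I02 y Q by apply: Qpt => //; exists L.
have [_ HS _] := PS; have [_ HS' _] := PS'.
have QS : I23 Q S by apply: (plane_sub_symp HS xQ); rewrite -E => ? [].
have QS' : I23 Q S' by apply: (plane_sub_symp HS' xQ); rewrite -E => ? [].
have [N [NQ xN yN]] := polar_plane_line (ms_symp_polar QS) QS xy xQ yQ.
have NS' : I13 N S' by exists Q.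
apply: LS; exists Q => //.
by rewrite (polar_line_uniq (ms_symp_polar QS') LS' NS' xy).
Qed.

(** When the two symps meet in a line, this line is a plane of the residue at [x],
    where the two symps are points of it and hence collinear. *)
Lemma metasymplectic_metasymp : metasymp I01 I12 I23.
Proof.
split.
- exact: ms_symp_polar.
- exact: ms_point_polar.
- move=> L P /line_plane_chamber[p [S /chamber_flags[? _ ?]]].
  by split; [exists p|exists S].
move=> x y S S' xy SS xS yS xS' yS'.
have [[HS xS1] [_ yS1]] := ((point_sympE _ _).1 xS, (point_sympE _ _).1 yS).
have [[HS' xS2] [_ yS2]] := ((point_sympE _ _).1 xS', (point_sympE _ _).1 yS').
have xI : (pts M S `&` pts M S') x by [].
have yI : (pts M S `&` pts M S') y by [].
have [E|[p _ E]|[L HL E]|[Q HQ E]] := MS3 HM HS HS' SS; rewrite E in xI yI => //.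
- by case: xy; rewrite xI yI.
- have xL : I01 x L by split.
  have yL : I01 y L by split.
  have LS := ms_line_in_symp xy xL yL xS yS.
  have LS' := ms_line_in_symp xy xL yL xS' yS'.
  have HX := ms_point_polar xL.
  have [||P [LP PS PS']] := polar_plane_line HX xL SS;
    try by rewrite (relcomp_dual I12 I23).
  by exists L, P.
- have xQ : I02 x Q by apply/point_planeE.
  have yQ : I02 y Q by apply/point_planeE.
  have QS : I23 Q S by apply: (plane_sub_symp HS xQ); rewrite -E => ? [].
  have QS' : I23 Q S' by apply: (plane_sub_symp HS' xQ); rewrite -E => ? [].
  have [N [NQ xN yN]] := polar_plane_line (ms_symp_polar QS) QS xy xQ yQ.
  by exists N, Q.
Qed.

End MetasymplecticSpace.

(** * Walks in graphs of large girth *)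

Section Walks.
Variables (T : Type) (A : set T) (e : T -> T -> Prop) (g : nat).
Hypotheses (eA : forall x y, e x y -> A x) (eC : forall x y, e x y -> e y x).
Hypothesis eI : forall x, ~ e x x.
Hypothesis girth_g : girth A e g.

Definition fwalk (f : nat -> T) n := forall i, (i < n)%N -> e (f i) (f i.+1).
Definition nonback (f : nat -> T) n := forall i, (i.+1 < n)%N -> f i <> f i.+2.

Lemma walkP n x y : walk e n x y <-> exists f, [/\ fwalk f n, f 0 = x & f n = y].
Proof.
elim: n x => [|n IH] x /=.
  by split=> [->|[f [_ <- <-]]//]; exists (fun=> y).
split=> [[z [xz /IH[f [fw f0 fn]]]]|[f [fw f0 fn]]].
  exists (fun i => if i is j.+1 then f j else x); split => // -[_|i]; last exact: fw.
  by rewrite f0.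
exists (f 1); split; first by rewrite -f0; apply: fw.
by apply/IH; exists (fun i => f i.+1); split => // i; apply: (fw i.+1).
Qed.

Lemma walk_cat n m x y z : walk e n x y -> walk e m y z -> walk e (n + m) x z.
Proof. by elim: n x => [|n IH] x /= => [->|[w [xw /IH H] /H]] //; exists w. Qed.

Lemma fwalk_walk f n i j : fwalk f n -> (i <= j <= n)%N -> walk e (j - i) (f i) (f j).
Proof.
move=> fw /andP[ij jn]; apply/walkP; exists (fun k => f (i + k)); split.
- move=> k kj; rewrite addnS; apply: fw; lia.
- by rewrite addn0.
- by rewrite subnKC.
Qed.

Lemma backtrack_walk f n i : fwalk f n -> (i.+1 < n)%N -> f i = f i.+2 ->
  walk e (n - 2) (f 0) (f n).
Proof.
move=> fw i2 fi; have -> : (n - 2 = (i - 0) + (n - i.+2))%N by lia.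
apply: (@walk_cat _ _ _ (f i)); first by apply: (fwalk_walk fw); lia.
by rewrite fi; apply: (fwalk_walk fw); lia.
Qed.

Lemma nonback_of_min f n : fwalk f n ->
  (forall m, (m < n)%N -> ~ walk e m (f 0) (f n)) -> nonback f n.
Proof.
move=> fw min i i2 /(backtrack_walk fw i2); apply: min; lia.
Qed.

Lemma shortest_nonback n x y : walk e n x y ->
  exists m f, [/\ (m <= n)%N, fwalk f m, nonback f m, f 0 = x & f m = y].
Proof.
elim/ltn_ind: n => n IH /walkP[f [fw f0 fn]].
have [nb|] := EM (nonback f n); first by exists n, f.
move=> /existsNP[i /not_implyP[i2 /contrapT /(backtrack_walk fw i2)]].
rewrite f0 fn => /IH[|m [f' [mn ? ? ? ?]]]; first by lia.
by exists m, f'; split => //; lia.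
Qed.

(** Between two nearest visits to a same vertex, the walk is a cycle. *)
Lemma repeat_cycle f n i j : fwalk f n -> nonback f n -> (i < j <= n)%N ->
  f i = f j -> (g <= j - i)%N.
Proof.
move=> fw nb; move: {2}(j - i) (leqnn (j - i)) => d.
elim: d i j => [|d IH] i j dij /andP[ij jn] fij; first by lia.
have [[i' [j' [ii' i'j' j'j ne fij']]]|inj] := EM (exists i' j',
    [/\ i <= i', i' < j', j' <= j, (j' - i' < j - i) & f i' = f j'])%N.
  have : (g <= j' - i')%N by apply: IH => //; lia.
  lia.
have d3 : (2 < j - i)%N.
  rewrite ltnNge; apply/negP => d2.
  have [E|E] : (j = i.+1 \/ j = i.+2) by lia.
    by apply: (@eI (f i)); rewrite {2}fij E; apply: fw; lia.
  by apply: (nb i); [lia|rewrite -E].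
have [_ -> //] := girth_g; split => //.
exists (fun k : 'I_(j - i) => f (i + k)%N); split.
- move=> k; have kj := ltn_ord k; apply: (eA (y := f (i + k).+1)); apply: fw; lia.
- have aux (k l : 'I_(j - i)) : (k < l)%N -> f (i + k)%N <> f (i + l)%N.
    move=> kl E; apply: inj; have lj := ltn_ord l.
    by exists (i + k)%N, (i + l)%N; split => //; lia.
  move=> k l E; apply: val_inj => /=; have [kl|kl|//] := ltngtP k l.
    by case: (aux k l).
  by case: (aux l k).
- move=> k; have kj := ltn_ord k; rewrite /=.
  have [kd|kd] : (k.+1 < j - i)%N \/ k.+1 = (j - i)%N by lia.
    by rewrite modn_small // addnS; apply: fw; lia.
  have E : j = (i + k).+1 by lia.
  by rewrite kd modnn addn0 fij; rewrite (congr1 f E); apply: fw; lia.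
Qed.

(** After removing their common tail, two nonbacktracking walks with the same
    ends close up to a closed nonbacktracking walk. *)
Lemma nonback_shortest f h n m : fwalk f n -> nonback f n -> fwalk h m ->
  nonback h m -> f 0 = h 0 -> f n = h m -> (m < n)%N -> (g <= n + m)%N.
Proof.
elim: m n => [|m IH] n fw fb hw hb f0 fn mn.
  have := @repeat_cycle f n 0 n fw fb; rewrite subn0 addn0; apply; first by lia.
  by rewrite fn.
case: n fw fb fn mn => // n fw fb fn mn.
have [E|ne] := EM (f n = h m).
  have : (g <= n + m)%N.
    apply: IH => //; [move=> i ? ; apply: fw|move=> i ?; apply: fb
      |move=> i ?; apply: hw|move=> i ?; apply: hb]; lia.
  lia.
pose k i := if (i <= n.+1)%N then f i else h (n.+1 + m.+1 - i)%N.
have kf i : (i <= n.+1)%N -> k i = f i by rewrite /k => ->.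
have kh i : (n.+1 <= i)%N -> k i = h (n.+1 + m.+1 - i)%N.
  rewrite /k => ni; case: leqP => // i_n; have -> : i = n.+1 by lia.
  by rewrite fn; congr h; lia.
have := @repeat_cycle k (n.+1 + m.+1) 0 (n.+1 + m.+1); rewrite subn0; apply => //.
- move=> i im; have [i_n|n_i] := leqP i n.
    by rewrite !kf //; [apply: fw|]; lia.
  rewrite !kh; try lia; apply: eC.
  have -> : (n.+1 + m.+1 - i = (n.+1 + m.+1 - i.+1).+1)%N by lia.
  by apply: hw; lia.
- move=> i im; have [i_n|n_i] := ltnP i n.
    by rewrite !kf; try lia; apply: fb; lia.
  have [->|in'] : i = n \/ (n.+1 <= i)%N by lia.
    rewrite kf // kh; last by lia.
    by have -> : (n.+1 + m.+1 - n.+2 = m)%N by lia.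
  rewrite !kh; try lia.
  have -> : (n.+1 + m.+1 - i = (n.+1 + m.+1 - i.+2).+2)%N by lia.
  by apply: nesym; apply: hb; lia.
- by lia.
- by rewrite kf // kh ?subnn //; lia.
Qed.

(** Nonbacktracking walks as lists of vertices, so that for an explicit list the
    conditions unfold to its incidences and inequalities. *)
Fixpoint nonstammering (s : seq T) : Prop :=
  if s is a :: ((b :: r) as s') then
    [/\ e a b, (if r is c :: _ then a <> c else True) & nonstammering s']
  else True.

Lemma nonstammering_walk x0 s : nonstammering s ->
  fwalk (nth x0 s) (size s).-1 /\ nonback (nth x0 s) (size s).-1.
Proof.
elim: s => [|a [|b r] IH] // [ab ac H].
have [fw nb] := IH H; split=> -[|i] lti //; [exact: fw| |exact: nb].
by case: r ac lti {IH H fw nb}.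
Qed.

Lemma walk_nonstammering f n : fwalk f n -> nonback f n ->
  nonstammering (mkseq f n.+1).
Proof.
elim: n f => [|n IH] f fw nb //.
have -> : mkseq f n.+2 = f 0 :: mkseq (fun i => f i.+1) n.+1.
  by rewrite /mkseq /= (iotaDl 1 1) -map_comp.
have := IH (fun i => f i.+1).
case: n fw nb {IH} => [|n] fw nb IH /=; split => //.
- exact: fw.
- exact: fw.
- exact: nb.
apply: IH => i ?; [exact: fw|exact: nb].
Qed.

Lemma nonstammering_min x s n : nonstammering (x :: s) -> walk e n x (last x s) ->
  (n < size s)%N -> (g <= size s + n)%N.
Proof.
move=> /(@nonstammering_walk x)[fw nb] /shortest_nonback[m [f [mn fw' nb' f0 fm]]] ns.
have : (g <= size s + m)%N.
  apply: (nonback_shortest fw nb fw' nb'); first by rewrite f0.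
    by rewrite fm (last_nth x).
  by rewrite /=; lia.
lia.
Qed.

End Walks.

(** * Paths in a generalised octagon *)

Section Octagon.
Variables (T : Type) (O : pregeometry T).
Hypothesis HO : generalised_octagon O.

Local Notation e := (incident O).

Let geoO : geometry O. Proof. by case: HO. Qed.
Let rO : rank O = 2. Proof. by case: HO. Qed.

Lemma point_not_line x : points O x -> ~ lines O x.
Proof.
move=> px lx; case: geoO => dis _ _.
have : (elts O 0 `&` elts O 1) x by split.
by rewrite dis // rO.
Qed.

Lemma octagon_incident u v : e u v ->
  (points O u /\ lines O v) \/ (lines O u /\ points O v).
Proof.
case=> c [i [j [cO ij cu cv]]].
case: geoO => _ _ ch; have [sz el] := ch c cO.
have ir : (i < 2)%N by rewrite -rO -sz -onthTE cu.
have jr : (j < 2)%N by rewrite -rO -sz -onthTE cv.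
have := el _ _ cu; have := el _ _ cv.
case: i ir ij {cu} => [|[|//]] _; case: j jr {cv} => [|[|//]] _ // _ ? ?.
  by left.
by right.
Qed.

Lemma point_incident x L : points O x -> e x L -> lines O L.
Proof. by move=> px /octagon_incident[[]//|[/(point_not_line px)]]. Qed.

Lemma line_incident L x : lines O L -> e L x -> points O x.
Proof. by move=> lL /octagon_incident[[/point_not_line]|[]]. Qed.

Lemma octagon_eA u v : e u v -> elements O u.
Proof.
by move=> /octagon_incident[[? _]|[? _]]; [exists 0|exists 1]; rewrite //= rO.
Qed.

Lemma octagon_eI u : ~ e u u.
Proof. by move=> /octagon_incident[] [/point_not_line].
Qed.

Lemma fwalk_types x f n : fwalk e f n -> f 0 = x -> points O x -> forall i, (i <= n)%N ->
  if odd i then lines O (f i) else points O (f i).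
Proof.
move=> fw f0 px; elim=> [|i IH] ilt; first by rewrite f0.
have := fw i ilt; have := IH (ltnW ilt); rewrite /=.
by case: (odd i) => /= ?; [apply: line_incident|apply: point_incident].
Qed.

Lemma octagon_min x s n : nonstammering e (x :: s) -> walk e n x (last x s) ->
  (n < size s)%N -> (16 <= size s + n)%N.
Proof.
case: HO => _ _ _ gir _; apply: (nonstammering_min octagon_eA _ octagon_eI gir).
exact: incidentC.
Qed.

Local Notation ocol := (fun x y => x <> y /\ collinear O x y).

Lemma collinear_walk n x y : walk ocol n x y -> walk e n.*2 x y.
Proof.
elim: n x => [|n IH] x //= [z [[_ [L HL [[_ xL] [_ zL]]]] /IH H]].
by exists L; split => //; exists z; split => //; apply: incidentC.
Qed.

Lemma nonstammering_collinear x s n : points O x -> nonstammering e (x :: s) ->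
  size s = n.*2 -> walk ocol n x (last x s).
Proof.
elim: n x s => [|n IH] x [|L [|y s]] // px [xL xy [Ly _ ns]] [sz].
have HL := point_incident px xL; have py := line_incident HL Ly.
exists y; split; last exact: IH.
by split => //; exists L => //; split; split => //; apply: incidentC.
Qed.

(** A shorter path would close up to a circuit of length less than 16. *)
Lemma nonstammering_distance x s n : points O x -> nonstammering e (x :: s) ->
  size s = n.*2 -> (n <= 4)%N -> octagon_distance O x (last x s) n.
Proof.
move=> px ns sz n4; split; first exact: nonstammering_collinear.
move=> m mn /collinear_walk /(octagon_min ns); rewrite sz; lia.
Qed.

Lemma octagon_path x y : points O x -> points O y -> exists s,
  [/\ nonstammering e (x :: s), last x s = y & exists2 n, (n <= 4)%N & size s = n.*2].
Proof.
move=> px py; case: HO => _ _ [diam _] _ _.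
have [|| n n8 [/walkP[f [fw f0 fn]] min]] := diam x y.
- by exists 0; rewrite //= rO.
- by exists 0; rewrite //= rO.
have nb : nonback f n by apply: (nonback_of_min fw); rewrite f0 fn.
have ns := walk_nonstammering fw nb.
have mk : mkseq f n.+1 = x :: mkseq (fun i => f i.+1) n.
  by rewrite /mkseq /= (iotaDl 1 0) -map_comp f0.
exists (mkseq (fun i => f i.+1) n); split.
- by rewrite -mk.
- have -> : last x (mkseq (fun i => f i.+1) n) = last x (mkseq f n.+1) by rewrite mk.
  by rewrite (last_nth x) size_mkseq /= -[RHS]fn -(nth_mkseq x f (ltnSn n)) mk.
have := fwalk_types fw f0 px (leqnn n); rewrite fn.
case: (boolP (odd n)) => [_ /(point_not_line py)//|ev _].
by exists n./2; rewrite ?size_mkseq; lia.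
Qed.

(** The line [L] is at odd distance at most 8, hence at most 7, from [y]. *)
Lemma opposite_path x y L s : points O x -> points O y -> e x L ->
  nonstammering e (x :: s) -> last x s = y -> size s = 8 ->
  exists a K b N c M, nonstammering e [:: x; L; a; K; b; N; c; M; y].
Proof.
move=> px py xL ns ls s8; case: HO => _ _ [diam _] _ _.
have HL := point_incident px xL.
have [|| n n8 [/walkP[f [fw f0 fn]] _]] := diam L y.
- by exists 1; rewrite //= rO.
- by exists 0; rewrite //= rO.
pose k i := if i is j.+1 then f j else x.
have kw : fwalk e k n.+1 by case=> [|i] ?; rewrite /k ?f0 //; apply: fw.
have kn : k n.+1 = y by [].
have min m : (m < 8)%N -> ~ walk e m (k 0) y.
  by move=> m8; rewrite -ls => /(octagon_min ns); rewrite s8; lia.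
have n7 : n = 7.
  have := fwalk_types kw erefl px (leqnn n.+1); rewrite kn.
  case: (boolP (odd n.+1)) => [_ /(point_not_line py)//|ev _].
  have : ~ (n.+1 < 8)%N.
    move=> n8'; apply: (min _ n8'); apply/walkP; exists k; split => //.
  lia.
subst n.
have := walk_nonstammering kw (nonback_of_min kw _).
rewrite kn => /(_ min); rewrite /mkseq /= fn f0 => H.
by exists (f 1), (f 2), (f 3), (f 4), (f 5), (f 6).
Qed.

Lemma point_three_lines x : points O x -> exists a b c,
  [/\ a <> b, a <> c & b <> c] /\ [/\ e x a, e x b & e x c].
Proof.
move=> px; case: HO => _ _ _ _ [S [S' [_ H' Hx _]]].
have [a [b [c [ne [[_ ?] [_ ?] [_ ?]]]]]] := three_points_option H' (Hx x px).
by exists a, b, c.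
Qed.

Lemma line_three_points L : lines O L -> exists a b c,
  [/\ a <> b, a <> c & b <> c] /\ [/\ e a L, e b L & e c L].
Proof.
move=> HL; case: HO => _ _ _ _ [S [S' [H _ _ Hx]]].
have [a [b [c [ne [[_ ?] [_ ?] [_ ?]]]]]] := three_points_option H (Hx L HL).
by exists a, b, c.
Qed.

Lemma branch x L : points O x -> exists L' u,
  [/\ L' <> L, e x L', u <> x & e u L'].
Proof.
move=> px; have [a [b [_ [[ab _ _] [xa xb _]]]]] := point_three_lines px.
have [L' [LL xL]] : exists L', L' <> L /\ e x L'.
  have [E|aL] := EM (a = L); last by exists a.
  by exists b; split => //; rewrite -E; apply: nesym.
have [u [v [_ [[uv _ _] [uL vL _]]]]] := line_three_points (point_incident px xL).
have [E|ux] := EM (u = x); last by exists L', u.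
by exists L', v; split => //; rewrite -E; apply: nesym.
Qed.

End Octagon.

(** * Polarised embeddings *)

Section Embedding.
Variables (T : Type) (O M : pregeometry T).
Hypotheses (hM : metasymplectic M) (hO : generalised_octagon O).
Hypotheses (hOM : fully_embedded O M) (hiso : pseudo_isometric O M).
Hypothesis hpol : polarised O M.

Let C := metasymplectic_metasymp hM.
Local Notation e := (incident O).
Local Notation I01 := (point_line M).
Local Notation I12 := (line_plane_inc M).
Local Notation I23 := (plane_symp M).
Local Notation I02 := (relcomp I01 I12).
Local Notation I13 := (relcomp I12 I23).
Local Notation I03 := (point_symp I01 I12 I23).
Local Notation col := (col I01).
Local Notation cosymp := (cosymp I01 I12 I23).
Local Notation adjacent := (adjacent I23).
Local Notation path := (nonstammering e).

Ltac solve_path := rewrite /=; do ?split => //;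
  first [done | by apply: incidentC | by apply: nesym].

Lemma octagon_on x L : points O x -> e x L -> I01 x L.
Proof.
case: hOM => pOM lOM inc _ px xL; have HL := point_incident hO px xL.
by split; [exact: lOM|split; [exact: pOM|exact/inc]].
Qed.

Lemma octagon_full w L : lines O L -> I01 w L -> points O w /\ e w L.
Proof.
case: hOM => _ _ inc full HL [_ wL]; have pw := full L HL w wL.
by split => //; apply/inc => //; case: wL.
Qed.

Lemma collinearE x y : collinear M x y <-> col x y.
Proof.
split=> [[L HL [xL yL]]|[L [HL xL] [_ yL]]]; last by exists L.
by exists L.
Qed.

Lemma path_neq x s n : points O x -> path (x :: s) -> size s = n.+1.*2 ->
  (n < 4)%N -> x <> last x s.
Proof.
move=> px ns sz n4 E; have := octagon_min hO (n := 0) ns E.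
by rewrite sz => /(_ isT); lia.
Qed.

Lemma path_end x s n : points O x -> path (x :: s) -> size s = n.*2 ->
  points O (last x s).
Proof.
elim: n x s => [|n IH] x [|L [|y s]] // px [xL _ [Ly _ ns]] [sz].
by apply: IH ns sz; apply: (line_incident hO (point_incident hO px xL) Ly).
Qed.

(** The numbers in the names of the lemmas on paths are lengths in the incidence
    graph, twice the distance of the points. *)
Lemma path4 x L z K y : points O x -> path [:: x; L; z; K; y] ->
  ~ col x y /\ cosymp x y.
Proof.
move=> px ns; have py := path_end (n := 2) px ns erefl.
have xy := path_neq (n := 1) px ns erefl isT.
have [_ [H _] _ _] := hiso px py xy.
have [_ nc [S [[HS [xS yS]] _]]] := H (nonstammering_distance hO (n := 2) px ns erefl isT).
by split=> [/collinearE//|]; exists S; apply/(point_sympE hM).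
Qed.

(** Two points of a symp have at least two common neighbours. *)
Lemma path6 x L a K b N y : points O x -> path [:: x; L; a; K; b; N; y] ->
  ~ cosymp x y.
Proof.
move=> px ns cs; have py := path_end (n := 3) px ns erefl.
have xy := path_neq (n := 2) px ns erefl isT.
have [_ _ [H _] _] := hiso px py xy.
have [_ _ [z [_ uz]]] := H (nonstammering_distance hO (n := 3) px ns erefl isT).
have [u [v [[uv _ _ _] [xu yu xv yv]]]] := two_neighbours C xy cs.
have zE w : col x w -> col y w -> z = w.
  by move=> xw yw; apply: uz; split; apply/collinearE.
by apply: uv; rewrite -(zE u xu yu) -(zE v xv yv).
Qed.

Lemma path8 x L a K b N c R y z : points O x ->
  path [:: x; L; a; K; b; N; c; R; y] -> col x z -> ~ col y z.
Proof.
move=> px ns xz yz; have py := path_end (n := 4) px ns erefl.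
have xy := path_neq (n := 3) px ns erefl isT.
have [_ _ _ [H _]] := hiso px py xy.
by have [_ []] := H (nonstammering_distance hO (n := 4) px ns erefl isT); 
  exists z; split; apply/collinearE.
Qed.

Lemma polar_symp_on x S y L : points O x -> polar_symp O M x S ->
  e x L -> e y L -> I03 y S.
Proof.
move=> px [HS xS sub] xL yL; apply/(point_sympE hM); split => //.
have HL := point_incident hO px xL.
have py := line_incident hO HL (incidentC yL).
by apply: sub => //; exists L.
Qed.

Lemma polar_symp_pt x S : polar_symp O M x S -> I03 x S.
Proof. by case=> HS xS _; apply/point_sympE. Qed.

Lemma polar_symp_line x S L : points O x -> polar_symp O M x S -> e x L -> I13 L S.
Proof.
move=> px xS xL; have xL' := octagon_on px xL.
have [y yx yL] := line_other C xL'.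
have [_ yL'] := octagon_full (point_incident hO px xL) yL.
by apply: (line_in_symp C yx yL xL' (polar_symp_on px xS xL yL') (polar_symp_pt xS)).
Qed.

Lemma polar_symp_uniq x S S' : points O x -> polar_symp O M x S ->
  polar_symp O M x S' -> S = S'.
Proof.
move=> px xS xS'; have [L [_ [_ [_ [xL _ _]]]]] := point_three_lines hO px.
have [K [v [KL xK vx vK]]] := branch hO L px.
have HL := point_incident hO px xL.
have [u ux uL] := line_other C (octagon_on px xL).
have [pu uL'] := octagon_full HL uL.
have [nc _] : ~ col u v /\ cosymp u v.
  by apply: (path4 (L := L) (z := x) (K := K) pu); solve_path.
apply: contrapT => SS; apply: nc; apply: (col_two_symps C SS).
- exact: polar_symp_on px xS xL uL'.
- exact: polar_symp_on px xS xK vK.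
- exact: polar_symp_on px xS' xL uL'.
- exact: polar_symp_on px xS' xK vK.
Qed.

(** Points [u], [v] next to [x] and to [y] are special, hence not in a common symp,
    so that the symps at [x] and [y] are distinct. *)
Lemma symps_path2 x L y Sx Sy : points O x -> path [:: x; L; y] ->
  polar_symp O M x Sx -> polar_symp O M y Sy -> Sx <> Sy /\ adjacent Sx Sy.
Proof.
move=> px ns xS yS; have py := path_end (n := 1) px ns erefl.
case: ns => xL xy [Ly _ _].
have [L1 [u [LL xL1 ux uL1]]] := branch hO L px.
have [L2 [v [LL' yL2 vy vL2]]] := branch hO L py.
have pu : points O u.
  exact: (line_incident hO (point_incident hO px xL1) (incidentC uL1)).
have SS : Sx <> Sy.
  have : ~ cosymp u v.
    by apply: (path6 (L := L1) (a := x) (K := L) (b := y) (N := L2) pu); solve_path.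
  move=> nc E; apply: nc; exists Sx; first exact: polar_symp_on px xS xL1 uL1.
  by rewrite E; apply: polar_symp_on py yS yL2 vL2.
split => //; have yL := incidentC Ly.
have [N [P [_ _ _ ? ?]]] := two_points_two_symps C xy SS (polar_symp_pt xS)
  (polar_symp_on px xS xL yL) (polar_symp_on py yS yL xL) (polar_symp_pt yS).
by exists P.
Qed.

(** In a common plane, a point [u] next to [x] is collinear to all points of some
    line, and a point [v] next to [y] to one of these points; yet [u] and [v] are
    opposite. *)
Lemma symps_path4 x L z K y Sx Sy : points O x -> path [:: x; L; z; K; y] ->
  polar_symp O M x Sx -> polar_symp O M y Sy ->
  [/\ Sx <> Sy, ~ adjacent Sx Sy & forall w, I03 w Sx -> I03 w Sy -> w = z].
Proof.
move=> px ns xS yS; have py := path_end (n := 2) px ns erefl.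
case: ns => xL xz [Lz LK [zK zy [Ky _ _]]].
have [L1 [u [LL xL1 ux uL1]]] := branch hO L px.
have [L2 [v [LL' yL2 vy vL2]]] := branch hO K py.
have pu : points O u.
  exact: (line_incident hO (point_incident hO px xL1) (incidentC uL1)).
have uS := polar_symp_on px xS xL1 uL1; have vS := polar_symp_on py yS yL2 vL2.
have SS : Sx <> Sy.
  have : ~ cosymp u y.
    by apply: (path6 (L := L1) (a := x) (K := L) (b := z) (N := K) pu); solve_path.
  by move=> nc E; apply: nc; exists Sx => //; rewrite E; apply: polar_symp_pt yS.
have uv w : col u w -> ~ col v w.
  by apply: (path8 (L := L1) (a := x) (K := L) (b := z) (N := K) (c := y) (R := L2) pu);
    solve_path.
have nadj : ~ adjacent Sx Sy.
  move=> [P PSx PSy]; have [k kP uk] := col_line_in_plane C uS PSx.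
  have [w wk vw] := col_proj C vS (ex_intro2 _ _ P kP PSy : I13 k Sy).
  exact: (uv w (uk w wk)).
split => // w wSx wSy; apply: contrapT => wz; apply: nadj.
have [N [P [_ _ _ ? ?]]] := two_points_two_symps C wz SS wSx
  (polar_symp_on px xS xL (incidentC Lz)) wSy (polar_symp_on py yS (incidentC Ky) zK).
by exists P.
Qed.

Lemma path_rev6 x L a K b N y : path [:: x; L; a; K; b; N; y] ->
  path [:: y; N; b; K; a; L; x].
Proof. by case=> ? ? [? ? [? ? [? ? [? ? [? ? _]]]]]; solve_path. Qed.

(** On a line through [x] leaving the path, [p] has a neighbour [w]; unless
    [w = x], the point [w] is opposite to [y], but it has a common neighbour
    with [y] because [p] lies in the symp at [y]. *)
Lemma common_point_col x L a K b N y Sx Sy p : points O x ->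
  path [:: x; L; a; K; b; N; y] ->
  polar_symp O M x Sx -> polar_symp O M y Sy -> I03 p Sx -> I03 p Sy -> col p x.
Proof.
move=> px ns xS yS pSx pSy.
have [L1 [u [LL xL1 ux uL1]]] := branch hO L px.
have [w wL1 pw] := col_proj C pSx (polar_symp_line px xS xL1).
have [<-//|wx] := EM (w = x).
have [pO wL1'] := octagon_full (point_incident hO px xL1) wL1.
have [v wv yv] := col_near_symp C pSy (polar_symp_pt yS) (colC pw).
case: ns => xL xa H.
have /path8 : path [:: w; L1; x; L; a; K; b; N; y] by case: H => ? ? ?; solve_path.
by move=> /(_ v pO wv) /(_ yv).
Qed.

(** A common point would be collinear to [y], hence provide a common neighbour of
    [y] and of a point [u] of the symp at [x] that is opposite to [y]. *)
Lemma symps_path6_disjoint x L a K b N y Sx Sy p : points O x ->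
  path [:: x; L; a; K; b; N; y] ->
  polar_symp O M x Sx -> polar_symp O M y Sy -> I03 p Sx -> I03 p Sy -> False.
Proof.
move=> px ns xS yS pSx pSy; have py := path_end (n := 3) px ns erefl.
have py' := common_point_col py (path_rev6 ns) yS xS pSy pSx.
have [L1 [u [LL xL1 ux uL1]]] := branch hO L px.
have pu : points O u.
  exact: (line_incident hO (point_incident hO px xL1) (incidentC uL1)).
have [v yv uv] := col_near_symp C pSx (polar_symp_on px xS xL1 uL1) (colC py').
case: ns => xL xa H.
have /path8 : path [:: u; L1; x; L; a; K; b; N; y] by case: H => ? ? ?; solve_path.
by move=> /(_ v pu uv) /(_ yv).
Qed.

Lemma plane_inter P S S' : S <> S' -> I23 P S -> I23 P S' ->
  pts M S `&` pts M S' = pts M P.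
Proof.
move=> SS PS PS'; have [HP HS _] := PS; have [_ HS' _] := PS'.
apply/seteqP; split=> [x [xS xS']|x xP].
  have /(point_planeE hM)[] // : I02 x P.
  by apply: (adjacent_inter C SS PS PS'); apply/(point_sympE hM).
by split; [exact: (plane_symp_sub hM PS)|exact: (plane_symp_sub hM PS')].
Qed.

Lemma symp_adjacentE S S' : symps M S -> symps M S' ->
  symp_adjacent M S S' <-> S <> S' /\ adjacent S S'.
Proof.
move=> HS HS'; split=> -[SS]; last first.
  move=> [P PS PS']; split => //; exists P; last exact: plane_inter.
  by case: PS.
move=> [P HP E]; split => //.
have [q qP] := plane_point hM HP HS.
by exists P; apply: (plane_sub_symp hM _ qP) => // x; rewrite -E => -[].
Qed.

(** In the residue at [a], the symp at [x] is collinear to all points of a line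
    [R] of the plane [K]; in the residue at [b], the symp at [y] is collinear to a
    point of [R]. *)
Lemma symps_path6_bridge x L a K b N y Sx Sy : points O x ->
  path [:: x; L; a; K; b; N; y] ->
  polar_symp O M x Sx -> polar_symp O M y Sy ->
  exists S, [/\ S <> Sx, S <> Sy, adjacent Sx S, adjacent Sy S & I13 K S].
Proof.
move=> px ns xS yS; case: (ns) => xL xa [La LK [aK ab [Kb KN [bN nby [Ny _ _]]]]].
have pa := path_end (n := 1) (s := [:: L; a]) px (And3 xL xa (And3 La I I)) erefl.
have pb : points O b by apply: (line_incident hO (point_incident hO pa aK) Kb).
have [Sa aS] := hpol pa; have [Sb bS] := hpol pb.
have aSx := polar_symp_on px xS xL (incidentC La).
have py := path_end (n := 3) px ns erefl.
have bSy := polar_symp_on py yS (incidentC Ny) bN.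
have [_ _ xb] : [/\ Sx <> Sb, ~ adjacent Sx Sb & forall w, I03 w Sx -> I03 w Sb -> w = a].
  by apply: (symps_path4 px _ xS bS (L := L) (K := K)); solve_path.
have [_ _ ay] : [/\ Sa <> Sy, ~ adjacent Sa Sy & forall w, I03 w Sa -> I03 w Sy -> w = b].
  by apply: (symps_path4 pa _ aS yS (L := K) (K := N)); solve_path.
have bSx : ~ I03 b Sx by move=> h; apply: ab; rewrite (xb b h (polar_symp_pt bS)).
have aSy : ~ I03 a Sy by move=> h; apply: ab; apply: (ay a _ h); apply: polar_symp_pt.
have aK' := octagon_on pa aK; have bK' := octagon_on pb (incidentC Kb).
have [R KR SxR] := perp_line (point_polar C aK') aSx aK'.
have [S RS [P [_ PSy PS]]] := polar_proj (point_polar C bK') bSy (line_on_plane bK' KR).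
have [P' [_ PSx PS']] := SxR S RS.
have KS : I13 K S by exists R.
exists S; split => //.
- by move=> E; apply: bSx; rewrite -E; exists K.
- by move=> E; apply: aSy; rewrite -E; exists K.
- by exists P'.
- by exists P.
Qed.

(** A common point [p] is collinear to a point [w] on the first line and to one on
    the last.  As in [common_point_col], [w] cannot be opposite to [y], and so [p]
    is collinear to [a] and, symmetrically, to [c].  By convexity it lies in the
    symp at [b], which meets the symp at [x] in [a] alone and that at [y] in [c]
    alone. *)
Lemma symps_path8_disjoint x L a K b N c R y Sx Sy p : points O x ->
  path [:: x; L; a; K; b; N; c; R; y] ->
  polar_symp O M x Sx -> polar_symp O M y Sy -> I03 p Sx -> I03 p Sy -> False.
Proof.
move=> px ns xS yS pSx pSy; have py := path_end (n := 4) px ns erefl.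
case: (ns) => xL xa [La LK [aK ab [Kb KN [bN bc [Nc NR [cR cy [Ry _ _]]]]]]].
have rev : path [:: y; R; c; N; b; K; a; L; x] by solve_path.
have pa : points O a := line_incident hO (point_incident hO px xL) La.
have pb : points O b := line_incident hO (point_incident hO pa aK) Kb.
have pc : points O c := line_incident hO (point_incident hO pb bN) Nc.
have far w S u : col w p -> I03 p S -> I03 u S -> exists2 v, col w v & col u v.
  by move=> wp pS uS; apply: col_near_symp uS wp.
have pa' : col p a.
  have [w wL pw] := col_proj C pSx (polar_symp_line px xS xL).
  have [<-//|wa] := EM (w = a).
  have [pw' wL'] := octagon_full (point_incident hO px xL) wL.
  have [v wv yv] := far w Sy y (colC pw) pSy (polar_symp_pt yS).
  have /path8 : path [:: w; L; a; K; b; N; c; R; y] by solve_path.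
  by move=> /(_ v pw' wv) /(_ yv).
have pc' : col p c.
  have [w wR pw] := col_proj C pSy (polar_symp_line py yS (incidentC Ry)).
  have [<-//|wc] := EM (w = c).
  have [pw' wR'] := octagon_full (point_incident hO pc cR) wR.
  have [v wv xv] := far w Sx x (colC pw) pSx (polar_symp_pt xS).
  have /path8 : path [:: w; R; c; N; b; K; a; L; x] by solve_path.
  by move=> /(_ v pw' wv) /(_ xv).
have [nac _] : ~ col a c /\ cosymp a c.
  by apply: (path4 (L := K) (z := b) (K := N) pa); solve_path.
have [Sb bS] := hpol pb.
have aSb := polar_symp_on pb bS (incidentC Kb) aK.
have cSb := polar_symp_on pb bS bN (incidentC Nc).
have pSb := symp_convex C aSb cSb nac pa' pc'.
have [_ _ xb] : [/\ Sx <> Sb, ~ adjacent Sx Sb & forall w, I03 w Sx -> I03 w Sb -> w = a].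
  by apply: (symps_path4 px _ xS bS (L := L) (K := K)); solve_path.
have [_ _ by_] : [/\ Sb <> Sy, ~ adjacent Sb Sy & forall w, I03 w Sb -> I03 w Sy -> w = c].
  by apply: (symps_path4 pb _ bS yS (L := N) (K := R)); solve_path.
have E : a = c by rewrite -(xb p pSx pSb) -(by_ p pSb pSy).
by apply: nac; rewrite -E; apply: symp_refl aSb.
Qed.

Lemma symps_path6_special x L a K b N y Sx Sy : points O x ->
  path [:: x; L; a; K; b; N; y] ->
  polar_symp O M x Sx -> polar_symp O M y Sy -> symp_special M Sx Sy.
Proof.
move=> px ns xS yS.
have dis p : I03 p Sx -> I03 p Sy -> False by apply: symps_path6_disjoint ns xS yS.
have SS : Sx <> Sy.
  by move=> E; apply: (dis x); [|rewrite -E]; apply: polar_symp_pt.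
have [[HSx _ _] [HSy _ _]] := (xS, yS).
split => //; have [S [Sx' Sy' SxS SyS KS]] := symps_path6_bridge px ns xS yS.
have HS : symps M S by have /(line_sympE hM)[] := KS.
exists S; split=> [|S' [HS' [/symp_adjacentE[] // _ SxS' /symp_adjacentE[] // _ SyS']]].
  by split => //; split; apply/symp_adjacentE => //; split => //; apply: nesym.
apply: contrapT => ne.
have adjC U V : adjacent U V -> adjacent V U by case=> P; exists P.
have [p pSx pSy] := adjacent_two_common C ne SS (adjC _ _ SxS) (adjC _ _ SyS)
  (adjC _ _ SxS') (adjC _ _ SyS').
exact: dis pSx pSy.
Qed.

(** The symp at [b] would otherwise be a bridge as excluded by [no_bridge]. *)
Lemma common_adjacent_meets_path x L a K b N c R y Sx Sy S P1 P2 : points O x ->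
  path [:: x; L; a; K; b; N; c; R; y] ->
  polar_symp O M x Sx -> polar_symp O M y Sy ->
  I23 P1 Sx -> I23 P1 S -> I23 P2 Sy -> I23 P2 S -> I03 a S \/ I03 c S.
Proof.
move=> px ns xS yS P1x P1S P2y P2S; have py := path_end (n := 4) px ns erefl.
have dis p : I03 p Sx -> I03 p Sy -> False by apply: symps_path8_disjoint ns xS yS.
case: (ns) => xL xa [La LK [aK ab [Kb KN [bN bc [Nc NR [cR cy [Ry _ _]]]]]]].
have pa : points O a := line_incident hO (point_incident hO px xL) La.
have pb : points O b := line_incident hO (point_incident hO pa aK) Kb.
have [Sb bS] := hpol pb.
have [_ _ xb] : [/\ Sx <> Sb, ~ adjacent Sx Sb & forall w, I03 w Sx -> I03 w Sb -> w = a].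
  by apply: (symps_path4 px _ xS bS (L := L) (K := K)); solve_path.
have [_ _ by_] : [/\ Sb <> Sy, ~ adjacent Sb Sy & forall w, I03 w Sb -> I03 w Sy -> w = c].
  by apply: (symps_path4 pb _ bS yS (L := N) (K := R)); solve_path.
have [nac _] : ~ col a c /\ cosymp a c.
  by apply: (path4 (L := K) (z := b) (K := N) pa); solve_path.
have [aS|aS] := EM (I03 a S); first by left.
right; apply: contrapT => cS.
apply: (no_bridge C dis P1x P1S P2y P2S (polar_symp_on px xS xL (incidentC La)) aS
  (polar_symp_on py yS (incidentC Ry) cR) cS (polar_symp_on pb bS (incidentC Kb) aK)
  (polar_symp_on pb bS bN (incidentC Nc)) nac) => w wB wS; [exact: xb|exact: by_].
Qed.

Lemma symps_path8_opposite x y s Sx Sy : points O x ->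
  path (x :: s) -> last x s = y -> size s = 8 ->
  polar_symp O M x Sx -> polar_symp O M y Sy -> symp_opposite M Sx Sy.
Proof.
move=> px ns ls s8 xS yS.
have py : points O y by rewrite -ls; apply: (path_end (n := 4) px ns s8).
have [l1 [l2 [l3 [[l12 l13 l23] [xl1 xl2 xl3]]]]] := point_three_lines hO px.
have [a1 [k1 [b1 [n1 [c1 [r1 ns1]]]]]] := opposite_path hO px py xl1 ns ls s8.
have [a2 [k2 [b2 [n2 [c2 [r2 ns2]]]]]] := opposite_path hO px py xl2 ns ls s8.
have [a3 [k3 [b3 [n3 [c3 [r3 ns3]]]]]] := opposite_path hO px py xl3 ns ls s8.
have SS : Sx <> Sy.
  move=> E; apply: (symps_path8_disjoint px ns1 xS yS (polar_symp_pt xS)).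
  by rewrite -E; apply: polar_symp_pt.
split => // -[S [HS [hx hy]]].
have [[HSx _ _] [HSy _ _]] := (xS, yS).
have [SxS [P1 P1x P1S]] := (symp_adjacentE HSx HS).1 hx.
have [SyS [P2 P2y P2S]] := (symp_adjacentE HSy HS).1 hy.
have offS l a k b n c r l' a' k' b' n' c' r' : l <> l' ->
    path [:: x; l; a; k; b; n; c; r; y] -> path [:: x; l'; a'; k'; b'; n'; c'; r'; y] ->
    (I03 a S -> I03 a' S -> False) /\ (I03 c S -> I03 c' S -> False).
  move=> ll ns1' ns2'.
  case: (ns1') => xl xa [la lk [ak ab [kb kn [bn bc [nc nr [cr cy [ry _ _]]]]]]].
  case: (ns2') => xl' xa' [la' lk' [ak' ab' [kb' kn' [bn' bc' [nc' nr' [cr' cy' [ry' _ _]]]]]]].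
  have pa : points O a := line_incident hO (point_incident hO px xl) la.
  have pb : points O b := line_incident hO (point_incident hO pa ak) kb.
  have pc : points O c := line_incident hO (point_incident hO pb bn) nc.
  split=> [aS a'S|cS c'S].
    have [naa _] : ~ col a a' /\ cosymp a a'.
      by apply: (path4 (L := l) (z := x) (K := l') pa); solve_path.
    apply: naa; apply: (plane_col C (P := P1)).
      exact: (adjacent_inter C SxS P1x P1S (polar_symp_on px xS xl (incidentC la)) aS).
    exact: (adjacent_inter C SxS P1x P1S (polar_symp_on px xS xl' (incidentC la')) a'S).
  (* c and c' collinear would close this path to a circuit of length 14. *)
  have ns12 : path [:: c; n; b; k; a; l; x; l'; a'; k'; b'; n'; c'] by solve_path.
  have cc : c <> c' by move=> E; have := octagon_min hO (n := 0) ns12 E isT.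
  have pc' : points O c' := path_end (n := 6) pc ns12 erefl.
  have cc' : col c c'.
    apply: (plane_col C (P := P2)).
      exact: (adjacent_inter C SyS P2y P2S (polar_symp_on py yS (incidentC ry) cr) cS).
    exact: (adjacent_inter C SyS P2y P2S (polar_symp_on py yS (incidentC ry') cr') c'S).
  have [[_ /(_ ((collinearE _ _).2 cc'))[w1 _]] _ _ _] := hiso pc pc' cc.
  by have := octagon_min hO ns12 (collinear_walk w1) isT.
have h1 := common_adjacent_meets_path px ns1 xS yS P1x P1S P2y P2S.
have h2 := common_adjacent_meets_path px ns2 xS yS P1x P1S P2y P2S.
have h3 := common_adjacent_meets_path px ns3 xS yS P1x P1S P2y P2S.
have [? ?] := offS _ _ _ _ _ _ _ _ _ _ _ _ _ _ l12 ns1 ns2.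
have [? ?] := offS _ _ _ _ _ _ _ _ _ _ _ _ _ _ l13 ns1 ns3.
have [? ?] := offS _ _ _ _ _ _ _ _ _ _ _ _ _ _ l23 ns2 ns3.
tauto.
Qed.

(** Symps with a common point have two common neighbours, so they are neither
    special nor opposite. *)
Lemma common_point_not_special p S S' : I03 p S -> I03 p S' ->
  ~ symp_special M S S' /\ ~ symp_opposite M S S'.
Proof.
move=> pS pS'.
have [[HS _] [HS' _]] := ((point_sympE hM _ _).1 pS, (point_sympE hM _ _).1 pS').
have two : S <> S' -> exists U V, U <> V /\
    (symps M U /\ (symp_adjacent M S U /\ symp_adjacent M S' U)) /\
    (symps M V /\ (symp_adjacent M S V /\ symp_adjacent M S' V)).
  move=> SS; have [U [V [[UV US US' [VS VS']] [SU S'U SV S'V]]]] := two_adjacent C SS pS pS'.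
  have HU : symps M U by case: SU => P _ [].
  have HV : symps M V by case: SV => P _ [].
  exists U, V; split => //; split; split => //; split; apply/symp_adjacentE => //;
    by split => //; apply: nesym.
split=> -[SS]; have [U [V [UV [HU HV]]]] := two SS; last by case; exists U.
by move=> [W [_ W_uniq]]; apply: UV; rewrite -(W_uniq U HU) -(W_uniq V HV).
Qed.

Lemma adjacent_not_symplectic S S' : symps M S -> symps M S' ->
  symp_adjacent M S S' -> ~ symp_symplectic M S S'.
Proof.
move=> HS HS' /(symp_adjacentE HS HS')[SS [P PS PS']] [_ [p _]].
rewrite (plane_inter SS PS PS') => E.
have [q [L /(chamber_flags hM)[qL LP _]]] := plane_symp_chamber hM PS.
have [r rq rL] := line_other C qL.
have onP z : I01 z L -> z = p.
  move=> zL; have /(point_planeE hM)[_] : I02 z P by exists L.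
  by rewrite E.
by apply: rq; rewrite (onP r rL) (onP q qL).
Qed.

Lemma distance_uniq (e' : T -> T -> Prop) x y n m :
  distance e' x y n -> distance e' x y m -> n = m.
Proof.
move=> [wn minn] [wm minm]; have [nm|mn|//] := ltngtP n m.
  by case: (minm n nm).
by case: (minn m mn).
Qed.

Lemma relations_exclusive (R1 R2 R3 R4 Q1 Q2 Q3 Q4 : Prop) (d : nat -> Prop) n :
  (forall m, d m -> m = n) -> d n ->
  [/\ d 1 <-> R1, d 2 <-> R2, d 3 <-> R3 & d 4 <-> R4] ->
  (n = 1 /\ [/\ Q1, ~ Q2, ~ Q3 & ~ Q4]) \/ (n = 2 /\ [/\ ~ Q1, Q2, ~ Q3 & ~ Q4]) \/
  (n = 3 /\ [/\ ~ Q1, ~ Q2, Q3 & ~ Q4]) \/ (n = 4 /\ [/\ ~ Q1, ~ Q2, ~ Q3 & Q4]) ->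
  [/\ R1 <-> Q1, R2 <-> Q2, R3 <-> Q3 & R4 <-> Q4].
Proof.
move=> dn dd [h1 h2 h3 h4].
have ne m : m != n -> ~ d m by move=> mn /dn E; rewrite E eqxx in mn.
case=> [[E [? ? ? ?]]|[[E [? ? ? ?]]|[[E [? ? ? ?]]|[E [? ? ? ?]]]]]; subst n.
- have := ne 2 isT; have := ne 3 isT; have := ne 4 isT; split; tauto.
- have := ne 1 isT; have := ne 3 isT; have := ne 4 isT; split; tauto.
- have := ne 1 isT; have := ne 2 isT; have := ne 4 isT; split; tauto.
- have := ne 1 isT; have := ne 2 isT; have := ne 3 isT; split; tauto.
Qed.

Lemma polarised_strongly : strongly_polarised O M.
Proof.
split=> [x px|x y Sx Sy px py xy xS yS].
  have [S xS] := hpol px; exists S; split => // S' xS'.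
  exact: polar_symp_uniq px xS xS'.
have [[HSx _ _] [HSy _ _]] := (xS, yS).
have [s [ns ls [n n4 sz]]] := octagon_path hO px py.
have dn := nonstammering_distance hO px ns sz n4; rewrite ls in dn.
apply: (relations_exclusive _ dn (hiso px py xy)).
  by move=> m dm; apply: distance_uniq dm dn.
have share p : I03 p Sx -> I03 p Sy -> ~ symp_special M Sx Sy /\ ~ symp_opposite M Sx Sy.
  exact: common_point_not_special.
have nspecial : symp_opposite M Sx Sy -> ~ symp_special M Sx Sy.
  by move=> [_ no] [_ [S [HS _]]]; apply: no; exists S.
have nadj : (forall p, I03 p Sx -> I03 p Sy -> False) ->
    ~ symp_adjacent M Sx Sy /\ ~ symp_symplectic M Sx Sy.
  move=> dis; split=> [/(symp_adjacentE HSx HSy)[_ [P Px Py]]|[_ [p _ E]]].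
    have [q [L /(chamber_flags hM)[qL LP _]]] := plane_symp_chamber hM Px.
    by apply: (dis q); exists L => //; exists P.
  have [px' py'] : (pts M Sx `&` pts M Sy) p by rewrite E.
  by apply: (dis p); apply/(point_sympE hM).
case: n n4 sz dn => [|[|[|[|[|//]]]]] _.
- by case: s ns ls => // _ E; case: xy.
- case: s ns ls => [|L [|y' []]] // ns /= E _ _; rewrite {}E in ns.
  have [SS adj] := symps_path2 px ns xS yS.
  have adj' : symp_adjacent M Sx Sy by apply/symp_adjacentE.
  have xL : e x L by case: ns.
  have yL : e y L by case: ns => _ _ [? _ _]; apply: incidentC.
  have [? ?] := share x (polar_symp_pt xS) (polar_symp_on py yS yL xL).
  by left; split => //; split => //; apply: adjacent_not_symplectic.
- case: s ns ls => [|L [|z [|K [|y' []]]]] // ns /= E _ _; rewrite {}E in ns.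
  have [SS nadj' int] := symps_path4 px ns xS yS.
  have [xL zL zK yK] : [/\ e x L, e z L, e z K & e y K].
    by case: ns => ? _ [? _ [? _ [? _ _]]]; split => //; apply: incidentC.
  have zx := polar_symp_on px xS xL zL; have zy := polar_symp_on py yS yK zK.
  have [? ?] := share z zx zy.
  have sy : symp_symplectic M Sx Sy.
    split => //; have [_ [pz zSx]] := (point_sympE hM z Sx).1 zx.
    have [_ [_ zSy]] := (point_sympE hM z Sy).1 zy.
    exists z => //; apply/seteqP; split=> [w [wx wy]|w -> //].
    by apply: int; apply/(point_sympE hM).
  by right; left; split => //; split => // /(symp_adjacentE HSx HSy)[].
- case: s ns ls => [|L [|a [|K [|b [|N [|y' []]]]]]] // ns /= E _ _; rewrite {}E in ns.
  have sp := symps_path6_special px ns xS yS.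
  have [? ?] := nadj (fun p => @symps_path6_disjoint x L a K b N y Sx Sy p px ns xS yS).
  by right; right; left; split => //; split => // /nspecial.
- have op sz := symps_path8_opposite px ns ls sz xS yS.
  move=> sz _; have {}op := op sz.
  case: s ns ls sz => [|L [|a [|K [|b [|N [|c [|R [|y' []]]]]]]]] // ns /= E _.
  rewrite {}E in ns.
  have [? ?] := nadj (fun p => @symps_path8_disjoint x L a K b N c R y Sx Sy p px ns xS yS).
  by right; right; right; split => //; split => //; apply: nspecial.
Qed.

End Embedding.

Theorem theorem4p3 (T : Type) (O M : pregeometry T)
    (hM : metasymplectic M) (hO : generalised_octagon O)
    (hOM : fully_embedded O M) (hiso : pseudo_isometric O M) :
  strongly_polarised O M <-> polarised O M.
Proof.
split=> [[uniq _] x px|]; last exact: polarised_strongly.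
by have [S [xS _]] := uniq x px; exists S.
Qed.
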